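(* Let $K$ be a number field of degree $n$ over $\mathbb{Q}$ with ring of integers $\mathcal{O}$, let $p$ be a rational prime, let $1,\xi_2,\dots,\xi_n$ be an integral basis of $\mathcal{O}$, and put $\xi_1=1+p$. The prime $p$ is a common inessential divisor of the equation discriminants $\mathfrak{D}(\xi_0)$, $\xi_0\in\mathcal{O}$, if among the forms $$F_\kappa(w_0)=\prod_{d\mid\kappa}(w_d-w_0)^{\varepsilon_d}\qquad(\kappa=1,\dots,n)$$ there is at least one whose dimension $g(\kappa)$ with respect to $\xi_1,\dots,\xi_n$ is smaller than its degree $L_\kappa$, the exponent of $p$ in the norm $N(F_\kappa)$.
   Context: Here $u_1,\dots,u_n$ are indeterminates and $w_h=u_1\xi_1^{p^h}+\cdots+u_n\xi_n^{p^h}$ for $h\ge0$, so $w_d-w_0=\sum_i u_i(\xi_i^{p^d}-\xi_i)$. For $d\mid\kappa$, $\varepsilon_d=\mu(\kappa/d)$ with $\mu$ the Möbius function. The dimension of $F_\kappa(w_0)$ is its degree as a rational function in the symbols $\xi_1,\dots,\xi_n$, namely $g(\kappa)=\sum_{d\mid\kappa}\varepsilon_d\,p^d$. As a divisor, a form corresponds to the ideal generated by its coefficients: let $I_d$ be the (nonzero) ideal of $\mathcal{O}$ generated by $\xi_i^{p^d}-\xi_i$ ($i=1,\dots,n$); then $F_\kappa(w_0)$ corresponds to the fractional ideal $\prod_{d\mid\kappa}I_d^{\varepsilon_d}$, $N(F_\kappa)$ is the absolute norm of this fractional ideal, and $L_\kappa$ is the $p$-adic valuation of $N(F_\kappa)$.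 Common inessential divisor: fix an integral basis $\eta_1,\dots,\eta_n$ of $\mathcal{O}$; for $\xi_0\in\mathcal{O}$ write $\xi_0^k=\sum_i a_{ik}\eta_i$ ($k=0,\dots,n-1$), $a_{ik}\in\mathbb{Z}$. The equation discriminant $\mathfrak{D}(\xi_0)$, the discriminant of the degree $n$ (characteristic) equation of $\xi_0$, equals $|a_{ik}|^2D$ with $D$ the discriminant of $K$. The prime $p$ is a common inessential divisor of all equation discriminants if $p$ divides the determinant $|a_{ik}|$ for every $\xi_0\in\mathcal{O}$. *)

(* Defs.v *)
From HB Require Import structures.
From mathcomp Require Import all_boot all_order all_algebra all_field.
From mathcomp Require Import fraction.
From mathcomp.multinomials Require Import mpoly.
From Stdlib Require Import ClassicalEpsilon.

Set Implicit Arguments.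
Unset Strict Implicit.
Unset Printing Implicit Defensive.

Import GRing.Theory.
Local Open Scope ring_scope.

(* Only meaningful for m > 0. *)
Definition mobius (m : nat) : int :=
  if all (fun q => logn q m == 1%N) (primes m)
  then (-1) ^+ size (primes m) else 0.

(* Only meaningful for x != 0. *)
Definition padic_val (p : nat) (x : rat) : int :=
  (logn p `|numq x|%N)%:Z - (logn p `|denq x|%N)%:Z.

(* The ring R is arbitrary so that the xi_i can be taken either as symbols or
   as elements of a number field. *)
Definition w (R : comNzRingType) (n p : nat) (u xi : 'I_n -> R) (h : nat) : R :=
  \sum_(i < n) u i * xi i ^+ (p ^ h).

Definition formF (R : idomainType) (n p : nat) (u xi : 'I_n -> R) (k : nat) :
    {fraction R} :=
  \prod_(d <- divisors k)
    (FracField.tofrac (w p u xi d - w p u xi 0)) ^ mobius (k %/ d).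

(* Total degree of a rational function; the (size = degree + 1) shifts cancel.
   Only meaningful for f != 0. *)
Definition frac_degree (A : idomainType) (n : nat)
    (f : {fraction {mpoly A[n]}}) : int :=
  (msize \n_(repr f))%:Z - (msize \d_(repr f))%:Z.

(* Here the u_i and xi_i are all independent symbols, and the degree is the one
   in the xi_i, the u_i being counted as constants. *)
Definition dimensionF (n p k : nat) : int :=
  @frac_degree {mpoly int[n]} n
    (formF p (fun i => ('X_i)%:MP) (fun i => 'X_i) k).

Section NumberField.
Variable K : fieldExtType rat.
Implicit Types A B : K -> Prop.

Definition OK (x : K) : Prop := integralOver (intr : int -> K) x.

Definition integral_basis (n : nat) (b : 'I_n -> K) : Prop :=
  (forall i, OK (b i)) /\
  (forall x, OK x -> exists! c : {ffun 'I_n -> int}, x = \sum_i b i *~ c i).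

Definition idmul A B (x : K) : Prop :=
  exists m (a b : 'I_m -> K),
    [/\ forall i, A (a i), forall i, B (b i) & x = \sum_i a i * b i].

Definition idinv A (x : K) : Prop := forall y, A y -> OK (x * y).

Definition idexp A (z : int) : K -> Prop :=
  match z with
  | Posz m => iter m (idmul A) OK
  | Negz m => iter m.+1 (idmul (idinv A)) OK
  end.

(* The number of residue classes of OK modulo A. *)
Definition ideal_norm A : nat :=
  epsilon (inhabits 0%N) (fun N : nat =>
    exists r : 'I_N -> K, (forall i, OK (r i)) /\
      forall x, OK x -> exists! i, A (x - r i)).

(* The multiplicative extension to fractional ideals: N(A) = N(aA) / N(aOK) for
   any nonzero a in OK with aA contained in OK. *)
Definition frac_ideal_norm A : rat :=
  epsilon (inhabits 0) (fun q : rat =>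
    exists a : K, [/\ a != 0, OK a, forall y, A y -> OK (a * y) &
      q = (ideal_norm (fun x => exists2 y, A y & x = a * y))%:R
          / (ideal_norm (fun x => exists2 y, OK y & x = a * y))%:R]).

(* The ideal of OK generated by the coefficients of f. *)
Definition content (n : nat) (f : {mpoly K[n]}) (x : K) : Prop :=
  exists c : 'X_{1..n} -> K,
    (forall m, OK (c m)) /\ x = \sum_(m <- msupp f) c m * f@_m.

Definition idealI (n p : nat) (xi : 'I_n -> K) (d : nat) : K -> Prop :=
  let wxi := w p (fun i => 'X_i : {mpoly K[n]}) (fun i => (xi i)%:MP) in
  content (wxi d - wxi 0%N).

Definition divisorF (n p : nat) (xi : 'I_n -> K) (k : nat) : K -> Prop :=
  \big[idmul/OK]_(d <- divisors k) idexp (idealI p xi d) (mobius (k %/ d)).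

Definition normF (n p : nat) (xi : 'I_n -> K) (k : nat) : rat :=
  frac_ideal_norm (divisorF p xi k).

(* The index of x is the determinant of the matrix a of the coordinates of
   1, x, ..., x^(n-1) in the integral basis eta. *)
Definition common_inessential_divisor (n p : nat) (eta : 'I_n -> K) : Prop :=
  forall x : K, OK x -> forall a : 'M[int]_n,
    (forall k : 'I_n, x ^+ k = \sum_i eta i *~ a i k) -> (p %| \det a)%Z.

End NumberField.

(* Main.v *)
Require Import Defs.
From HB Require Import structures.
From mathcomp Require Import all_boot all_order all_algebra all_field.
From mathcomp Require Import fraction.
From mathcomp.multinomials Require Import mpoly.
From mathcomp Require Import ring zify.
From Stdlib Require Import ClassicalEpsilon.

Set Implicit Arguments.
Unset Strict Implicit.
Unset Printing Implicit Defensive.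

Import Order.TTheory GRing.Theory Num.Theory.
Local Open Scope ring_scope.

(** Suppose that some integral [x] has index prime to [p].  After inversion of
    the integers prime to [p], the ring of integers becomes Z[x], so that its
    structure at [p] can be read off from a monic equation [f] of [x] of degree
    [n], taken modulo [p].

    Locally at [p], the ideal I_d is generated by [p] and [x^(p^d) - x]: the
    choice xi_1 = 1 + p puts [p], times an integer prime to [p], into I_d; and
    modulo [p] the map [y |-> y^(p^d) - y] is additive on the integers of K and
    sends each [h(x)] to a multiple of [x^(p^d) - x].  Hence the norm of I_d has
    [p]-adic valuation deg gcd (f mod p, X^(p^d) - X) ([index_pair_ideal]).
    The ring being integrally closed, an argument of Dedekind ([dedekind])
    shows that I_d is even principal at [p] ([local_generator]).  Products and
    inverses of ideals principal at [p] are governed by products and inverses of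
    their generators ([loc_principalM], [loc_principalV]), and the index of a
    principal ideal is multiplicative ([pvalM]); so [loc_principal_norm] gives
      L_k = sum_(d | k) mu(k / d) deg gcd (f mod p, X^(p^d) - X).

    In a field F with [p^k] elements the degree of this gcd is the number of
    roots [r] of [f] in F with [r^(p^d) = r], while [p^d] is the number of all
    [r] in F with [r^(p^d) = r].  So L_k and g(k) = sum_(d | k) mu(k / d) p^d are
    sums of the same terms, one for each [r], the first over the roots of [f] and
    the second over all of F.  By Moebius inversion these terms are 0 or 1,
    in particular nonnegative ([mobius_period_ge0]), whence L_k <= g(k)
    ([sum_mobius_size_gcd]): no form has a dimension smaller than its degree. *)

(** * Moebius sums and roots in finite fields *)

Lemma mobius_primeM (q e : nat) : prime q -> (0 < e)%N ->
  mobius (q * e) = if (q %| e)%N then 0 else - mobius e.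
Proof.
move=> pq e0; have q0 := prime_gt0 pq.
have lM r : logn r (q * e) = ((r == q) && prime r + logn r e)%N.
  by rewrite lognM // logn_prime //; case: eqP => [->|]; rewrite ?pq ?andbF.
rewrite /mobius; case: (boolP (q %| e)%N) => [qe|qNe].
  have/negbTE-> : ~~ all (fun r => logn r (q * e) == 1)%N (primes (q * e)).
    apply/allPn; exists q; first by rewrite primesM // primes_prime // inE eqxx.
    by rewrite lM eqxx pq /= eqSS -lt0n logn_gt0 mem_primes pq e0.
  by [].
have qNp : q \notin primes e by rewrite mem_primes pq e0.
have pP : perm_eq (primes (q * e)) (q :: primes e).
  apply: uniq_perm; rewrite /= ?primes_uniq ?qNp // => r.
  by rewrite primesM // primes_prime // !inE.
rewrite (perm_all _ pP) (perm_size pP) /= lM eqxx pq /=.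
rewrite (logn_coprime (p := q)) ?prime_coprime // eqxx /=.
have -> : all (fun r => logn r (q * e) == 1)%N (primes e) =
          all (fun r => logn r e == 1)%N (primes e).
  apply: eq_in_all => r re; rewrite lM; have [rq|//] := eqVneq r q.
  by rewrite -rq re in qNp.
by case: ifP; rewrite ?oppr0 // exprS mulN1r.
Qed.

(** Fix a prime divisor [q] of [m].  The divisors [q e'] of [m] with [q] not
    dividing [e'] cancel against the [e'], and those divisible by [q^2] do not
    contribute. *)
Lemma sum_mobius (m : nat) : (0 < m)%N ->
  \sum_(e <- divisors m) mobius e = (m == 1%N)%:R.
Proof.
move=> m0; case: eqP => [->|/eqP m1].
  by rewrite (_ : divisors 1 = [:: 1%N]) // big_seq1.
have pq : prime (pdiv m) by apply: pdiv_prime; case: m m0 m1 => [|[]].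
set q := pdiv m in pq; have q0 := prime_gt0 pq.
have [m' Em] : exists m', m = (q * m')%N.
  by exists (m %/ q)%N; rewrite mulnC divnK // pdiv_dvd.
have m'0 : (0 < m')%N by move: m0; rewrite Em muln_gt0 => /andP[].
rewrite (bigID (fun e => q %| e)%N) /= -[X in X + _]big_filter.
have pA : perm_eq [seq e <- divisors m | (q %| e)%N]
                  [seq (q * e)%N | e <- divisors m'].
  apply: uniq_perm.
  - by rewrite filter_uniq // divisors_uniq.
  - rewrite map_inj_uniq ?divisors_uniq // => a b /eqP.
    by rewrite eqn_pmul2l // => /eqP.
  - move=> e; rewrite mem_filter -dvdn_divisors //.
    apply/andP/mapP => [[/dvdnP[c ->]]|[c]].
      rewrite Em mulnC dvdn_pmul2l // => h; exists c => //.
      by rewrite -dvdn_divisors.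
    by rewrite -dvdn_divisors // => h ->; rewrite dvdn_mulr // Em dvdn_pmul2l.
rewrite (perm_big _ pA) big_map.
rewrite -[X in _ + X]big_filter.
have pB : perm_eq [seq e <- divisors m | ~~ (q %| e)%N]
                  [seq e <- divisors m' | ~~ (q %| e)%N].
  apply: uniq_perm; rewrite ?filter_uniq ?divisors_uniq // => e.
  rewrite !mem_filter -!dvdn_divisors //; case: (boolP (q %| e)%N) => //= qe.
  by rewrite Em Gauss_dvdr // coprime_sym prime_coprime.
rewrite (perm_big _ pB) big_filter.
rewrite [X in X + _](bigID (fun e => q %| e)%N) /= big1_seq ?add0r; last first.
  move=> e /andP[qe]; rewrite -dvdn_divisors // => em.
  by rewrite mobius_primeM // ?qe // (dvdn_gt0 m'0).
rewrite [X in X + _]big_seq_cond [X in _ + X]big_seq_cond -big_split /=.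
rewrite big1 // => e; rewrite -dvdn_divisors // => /andP[em qe].
by rewrite mobius_primeM // ?(negbTE qe) ?addNr // (dvdn_gt0 m'0).
Qed.

(** A set of periods closed under sums and differences consists of the multiples
    of its least positive element, so that the sum is a full Moebius sum over the
    divisors of a quotient of [k]. *)
Lemma mobius_period_ge0 (k : nat) (D : pred nat) : (0 < k)%N -> D k ->
    (forall a b, D a -> D (a + b)%N = D b) ->
  0 <= \sum_(d <- divisors k | D d) mobius (k %/ d).
Proof.
move=> k0 Dk DD.
have ex : exists d, (0 < d)%N && D d by exists k; rewrite k0.
case: (ex_minnP ex) => dl /andP[dl0 Ddl] min {ex}.
have D0 : D 0%N by rewrite -(DD k) // addn0.
have Dmul a : D (a * dl)%N by elim: a => // a IH; rewrite mulSn DD.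
(* The remainder of a period modulo dl is a smaller period. *)
have DE d : D d = (dl %| d)%N.
  rewrite [in LHS](divn_eq d dl) DD //; apply/idP/eqP => [Dm|-> //].
  apply/eqP; rewrite -leqn0 leqNgt; apply/negP => h.
  by have := min _ (introT andP (conj h Dm)); rewrite leqNgt ltn_mod dl0.
have dk : (dl %| k)%N by rewrite -DE.
have [k' Ek] : exists k', k = (k' * dl)%N.
  by exists (k %/ dl)%N; rewrite divnK.
have k'0 : (0 < k')%N by move: k0; rewrite Ek muln_gt0 => /andP[].
suff pP : perm_eq [seq (k %/ d)%N | d <- divisors k & D d] (divisors k').
  by rewrite -big_filter -(big_map (fun d => k %/ d)%N xpredT) (perm_big _ pP)
             sum_mobius // ler0n.
apply: uniq_perm; rewrite ?divisors_uniq //.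
  rewrite map_inj_in_uniq ?filter_uniq ?divisors_uniq // => a b.
  rewrite !mem_filter -!dvdn_divisors // => /andP[_ ak] /andP[_ bk] E.
  have K c : (c %| k)%N -> (k %/ (k %/ c) = c)%N.
    by move=> ck; rewrite -{1}(divnK ck) mulKn // divn_gt0 ?(dvdn_leq k0) ?(dvdn_gt0 k0).
  by rewrite -(K _ ak) E K.
move=> e; rewrite -dvdn_divisors //; apply/mapP/idP => [[d]|ek'].
  rewrite mem_filter -dvdn_divisors // DE => /andP[/dvdnP[c ->] ck] ->.
  have c0 : (0 < c)%N by move: ck; case: c => //; rewrite dvd0n => /eqP; lia.
  move: ck; rewrite Ek dvdn_pmul2r // => /dvdnP[x ->].
  by rewrite -mulnA mulnK ?muln_gt0 ?c0 ?dl0 // dvdn_mulr.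
have e0 := dvdn_gt0 k'0 ek'.
exists (k' %/ e * dl)%N.
  rewrite mem_filter -dvdn_divisors // DE dvdn_mull //= Ek dvdn_pmul2r //.
  by apply: dvdn_div.
by case/dvdnP: ek' Ek k'0 => x -> -> x0; rewrite mulnK //;
  rewrite -mulnA [(e * dl)%N]mulnC mulnA mulKn // muln_gt0; nia.
Qed.

(** The polynomial [X^#|F| - X] is the product of all [X - r], so that its
    divisors are the products of distinct [X - r]. *)
Lemma size_split_finField (F : finFieldType) (h : {poly F}) :
  h %| 'X^#|F| - 'X -> size h = #|[pred r | root h r]|.+1.
Proof.
rewrite finField_genPoly => /dvdp_prod_XsubC[m hm].
rewrite (eqp_size hm) size_prod_XsubC; congr _.+1.
rewrite cardE -[RHS](perm_size (s1 := mask m (index_enum F))) //.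
apply: uniq_perm; rewrite ?enum_uniq ?mask_uniq ?index_enum_uniq // => r.
by rewrite mem_enum inE (eqp_root hm) root_prod_XsubC.
Qed.

Lemma prime_field_embedding (p : nat) (F : finFieldType) (pc : p \in [pchar F]) :
  exists phi : {rmorphism 'F_p -> F}, True.
Proof.
by exists ((in_alg (pPrimeCharType pc)) : {rmorphism 'F_p -> pPrimeCharType pc}).
Qed.

(** Both sides become sums over the elements [r] of a field with [p^k] elements:
    the left one over the roots of [f], the right one over all elements.  The
    term of [r] is nonnegative because the [d] with [r^(p^d) = r] are periods. *)
Lemma sum_mobius_size_gcd (p k : nat) (f : {poly 'F_p}) :
    prime p -> (0 < k)%N ->
  \sum_(d <- divisors k)
     mobius (k %/ d) * (size (gcdp f ('X^(p ^ d) - 'X))).-1%:Z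
  <= \sum_(d <- divisors k) mobius (k %/ d) * (p ^ d)%:Z.
Proof.
move=> pp k0; have [F pc cF] := pPrimePowerField pp k0.
have [phi _] := prime_field_embedding pc.
pose D (r : F) d := r ^+ (p ^ d) == r.
have DD r a b : D r a -> D r (a + b)%N = D r b.
  by move=> /eqP h; rewrite /D expnD exprM h.
have Dk r : D r k by rewrite /D -cF expf_card.
have rootX d r : root ('X^(p ^ d) - 'X : {poly F}) r = D r d.
  by rewrite /root !hornerE subr_eq0.
have Xdvd d : (d %| k)%N -> ('X^(p ^ d) - 'X : {poly F}) %| 'X^#|F| - 'X.
  rewrite cF => /dvdnP[b ->]; rewrite mulnC expnM.
  elim: b => [|b IH]; first by rewrite expn0 expr1 subrr dvdp0.
  have -> : 'X^((p ^ d) ^ b.+1) - 'X =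
     ('X^((p ^ d) ^ b) ^+ (p ^ d) - 'X ^+ (p ^ d)) + ('X^(p ^ d) - 'X) :> {poly F}.
    by rewrite -exprM -expnSr; ring.
  by rewrite dvdp_add // subrXX dvdp_mulr.
pose fF := map_poly phi f.
have E1 d : (d %| k)%N -> (size (gcdp f ('X^(p ^ d) - 'X))).-1%:Z =
    \sum_(r : F) ((root fF r && D r d)%:R : int).
  move=> dk; rewrite -(size_map_poly phi) gcdp_map rmorphB /= map_polyXn map_polyX.
  rewrite size_split_finField; last by apply: dvdp_trans (Xdvd _ dk); apply: dvdp_gcdr.
  rewrite /= -natr_sum -big_mkcond /= sum1_card natz; congr (Posz _).
  by apply: eq_card => r; rewrite !inE root_gcd rootX.
have E2 d : (d %| k)%N -> (p ^ d)%:Z = \sum_(r : F) ((D r d)%:R : int).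
  move=> dk; have := size_split_finField (Xdvd _ dk).
  rewrite size_polyDl ?size_polyXn ?size_polyN ?size_polyX; last first.
    by rewrite ltnS -[X in (X < _)%N](expn0 p) ltn_exp2l ?prime_gt1 // (dvdn_gt0 k0).
  move=> [->]; rewrite -natr_sum -big_mkcond /= sum1_card natz; congr (Posz _).
  by apply: eq_card => r; rewrite !inE rootX.
have bd (G : F -> nat -> bool) (A : nat -> int) :
    (forall d, (d %| k)%N -> A d = \sum_(r : F) ((G r d)%:R : int)) ->
    \sum_(d <- divisors k) mobius (k %/ d) * A d =
    \sum_(r : F) \sum_(d <- divisors k | G r d) mobius (k %/ d).
  move=> hA; under [RHS]eq_bigr do rewrite big_mkcond.
  rewrite exchange_big /= [LHS]big_seq [RHS]big_seq; apply: eq_bigr => d.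
  rewrite -dvdn_divisors // => dk; rewrite hA // mulr_sumr; apply: eq_bigr => r _.
  by case: ifP; rewrite ?mulr1 ?mulr0.
rewrite (bd (fun r d => root fF r && D r d)) // (bd D) //.
apply: ler_sum => r _; case: (root fF r) => //=.
by rewrite big_pred0 // mobius_period_ge0 // => a b; apply: DD.
Qed.

(** * The degree of the form in the symbols xi_i *)

Lemma fraction_numden (R : idomainType) (F : {fraction R}) :
  F * FracField.tofrac (\d_(repr F)) = FracField.tofrac (\n_(repr F)).
Proof.
have [r Er] : exists r, r = repr F by exists (repr F).
rewrite -Er; have -> : F = (\pi_({fraction R}) r)%qT by rewrite Er reprK.
rewrite -[LHS]/(FracField.mul _ _) !piE.
apply/eqP; rewrite eqmodE /= /FracField.equivf /=.
by rewrite !numden_Ratio ?mulr1 ?oner_neq0 ?denom_ratioP // mulrC.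
Qed.

Section FractionDegree.
Variables (n : nat) (A : idomainType).
Local Notation B := {mpoly A[n]}.
Local Notation "x %:F" := (FracField.tofrac x).

(** The degree of a fraction read off from any of its representations, rather
    than from the canonical one used by [frac_degree]. *)
Definition has_degree (F : {fraction B}) (z : int) : Prop :=
  exists a b : B, [/\ a != 0, b != 0, F * b%:F = a%:F
    & z = (msize a)%:Z - (msize b)%:Z].

Lemma frac_degreeE (F : {fraction B}) (z : int) :
  has_degree F z -> frac_degree F = z.
Proof.
case=> a [b [a0 b0 E ->]]; rewrite /frac_degree.
have := fraction_numden F; have := denom_ratioP (repr F).
set d := \d_(repr F); set m := \n_(repr F) => d0 E'.
have Eab : m * b = a * d.
  by apply/eqP; rewrite -tofrac_eq !tofracM -E -E' -!mulrA [d%:F * _]mulrC.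
have m0 : m != 0.
  apply/eqP => m0; move/eqP: Eab.
  by rewrite m0 mul0r eq_sym mulf_eq0 (negbTE a0) (negbTE d0).
have S : (0 < msize m /\ 0 < msize b /\ 0 < msize a /\ 0 < msize d)%N.
  by rewrite !lt0n !msize_poly_eq0.
have := congr1 (mmeasure mdeg) Eab; rewrite !msizeM //; lia.
Qed.

Lemma has_degree1 : has_degree 1 0.
Proof. by exists 1, 1; rewrite oner_neq0 mul1r subrr. Qed.

Lemma has_degreeM F G y z :
  has_degree F y -> has_degree G z -> has_degree (F * G) (y + z).
Proof.
move=> [a [b [a0 b0 E ->]]] [c [d [c0 d0 E' ->]]].
exists (a * c), (b * d); rewrite !mulf_neq0 //; split=> //.
  by rewrite !tofracM mulrACA E E'.
have S : (0 < msize a /\ 0 < msize b /\ 0 < msize c /\ 0 < msize d)%N.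
  by rewrite !lt0n !msize_poly_eq0.
by rewrite !msizeM //; lia.
Qed.

Lemma has_degreeV F z : has_degree F z -> has_degree F^-1 (- z).
Proof.
move=> [a [b [a0 b0 E ->]]]; exists b, a; split=> //; last by rewrite opprB.
have F0 : F != 0.
  by apply: contraTneq a0 => F0; rewrite -tofrac_eq0 -E F0 mul0r eqxx.
by rewrite -E mulKf.
Qed.

Lemma has_degreeX F z (k : int) : has_degree F z -> has_degree (F ^ k) (z * k).
Proof.
move=> h; have hX m : has_degree (F ^+ m) (z * m%:Z).
  elim: m => [|m IH]; first by rewrite mulr0; apply: has_degree1.
  rewrite exprS (_ : z * m.+1 = z + z * m); first exact: has_degreeM.
  by rewrite -add1n PoszD mulrDr mulr1.
case: k => m; first exact: hX.
by rewrite NegzE mulrN; apply/has_degreeV/hX.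
Qed.

End FractionDegree.

(** The type annotation selects the ring structure through which [formF] builds
    its factors. *)
Lemma msize_w_diff (n p d : nat) : (0 < n)%N -> prime p -> (0 < d)%N ->
  let w_ := @w ({mpoly {mpoly int[n]}[n]} : idomainType) n p
              (fun i => ('X_i)%:MP) (fun i => 'X_i) in
  msize (w_ d - w_ 0) = (p ^ d).+1.
Proof.
move=> n0 pp d0 w_.
have q1 : (1 < p ^ d)%N by rewrite -[X in (X < _)%N](expn0 p) ltn_exp2l ?prime_gt1.
pose i0 := Ordinal n0.
have E : w_ d - w_ 0%N = \sum_(i < n) ('X_i : {mpoly int[n]}) *:
     ('X_i ^+ (p ^ d) - 'X_i : {mpoly {mpoly int[n]}[n]}).
  rewrite -sumrB; apply: eq_bigr => i _.
  by rewrite expr1 -mulrBr mul_mpolyC.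
apply/eqP; rewrite eqn_leq; apply/andP; split.
  rewrite E; apply: leq_trans (msize_sum _ _ _) _.
  apply/bigmax_leqP => i _; apply: leq_trans (msizeZ_le _ _) _.
  apply: leq_trans (msizeD_le _ _) _; rewrite msizeN geq_max mpolyXn !msizeX /=.
  by rewrite !mdegMn !mdeg1 mul1n; lia.
rewrite -[X in (X < _)%N](_ : mdeg (U_(i0) *+ (p ^ d))%MM = _); last first.
  by rewrite mdegMn mdeg1 mul1n.
apply: msize_mdeg_lt; rewrite mcoeff_msupp E raddf_sum /= (bigD1 i0) //= big1.
  rewrite mcoeffZ mcoeffB mcoeffXn eqxx mcoeffX.
  rewrite (_ : (U_(i0) == _)%MM = false) ?subr0 ?mulr1 ?addr0.
    by rewrite -msize_poly_eq0 msizeX mdeg1.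
  apply/eqP => /(congr1 (@mdeg n)); rewrite mdegMn mdeg1; lia.
move=> i ii0; rewrite mcoeffZ mcoeffB mcoeffXn mcoeffX.
rewrite (_ : (U_(i) *+ _ == _)%MM = false); last first.
  apply/eqP=> /mnmP /(_ i0); rewrite !mulmnE !mnm1E eqxx (negbTE ii0); lia.
rewrite (_ : (U_(i) == _)%MM = false) ?subrr ?mulr0 //.
by apply/eqP=> /mnmP /(_ i0); rewrite !mulmnE !mnm1E eqxx (negbTE ii0); lia.
Qed.

Lemma dimensionFE (n p k : nat) : (0 < n)%N -> prime p -> (0 < k)%N ->
  dimensionF n p k = \sum_(d <- divisors k) mobius (k %/ d) * (p ^ d)%:Z.
Proof.
move=> n0 pp k0; apply: frac_degreeE; rewrite /formF big_seq [X in has_degree _ X]big_seq.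
elim/big_rec2: _ => [|d z F dk IH]; first exact: has_degree1.
apply: has_degreeM => //; rewrite mulrC; apply: has_degreeX.
have d0 : (0 < d)%N by move: dk; rewrite -dvdn_divisors //; apply: dvdn_gt0.
set a := (w _ _ _ _ - _).
have Sa : msize a = (p ^ d).+1 by apply: msize_w_diff.
exists a, 1; split; rewrite ?oner_neq0 ?mulr1 //.
  by rewrite -msize_poly_eq0 Sa.
by rewrite Sa msize1; lia.
Qed.

(** * Indices of additive subgroups *)

Definition classicb (P : Prop) : bool :=
  if excluded_middle_informative P then true else false.

Lemma classicP (P : Prop) : reflect P (classicb P).
Proof. by rewrite /classicb; case: excluded_middle_informative => h; constructor. Qed.

Section Index.
Variable K : fieldType.
Implicit Types A B D : K -> Prop.

Definition subgroup A : Prop := A 0 /\ forall x y, A x -> A y -> A (x - y).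

Definition included A B : Prop := forall x, A x -> B x.

Definition dilate (a : K) A : K -> Prop := fun x => exists2 y, A y & x = a * y.

(** B has [N] cosets in A.  The representatives are indexed as in [ideal_norm],
    which is thereby the index of an ideal in the ring of integers. *)
Definition has_index A B (N : nat) : Prop :=
  exists r : 'I_N -> K, (forall i, A (r i)) /\
    forall x, A x -> exists! i, B (x - r i).

Lemma subgroupN A x : subgroup A -> A x -> A (- x).
Proof. by move=> [A0 AB] Ax; rewrite -sub0r; apply: AB. Qed.

Lemma subgroupD A x y : subgroup A -> A x -> A y -> A (x + y).
Proof. by move=> gA Ax Ay; rewrite -[y]opprK; apply: (proj2 gA) => //; apply: subgroupN. Qed.

Lemma subgroup_dilate a A : subgroup A -> subgroup (dilate a A).
Proof.
move=> [A0 AB]; split; first by exists 0; rewrite ?mulr0.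
by move=> _ _ [y Ay ->] [z Az ->]; exists (y - z); [apply: AB | rewrite mulrBr].
Qed.

Lemma index_finType (T : finType) (r : T -> K) A B :
    (forall i, A (r i)) -> (forall x, A x -> exists! i, B (x - r i)) ->
  has_index A B #|T|.
Proof.
move=> rA rB; exists (r \o enum_val); split=> [i|x Ax]; first exact: rA.
have [i [Bi ui]] := rB x Ax; exists (enum_rank i); split=> [|j Bj] /=.
  by rewrite enum_rankK.
by rewrite (ui _ Bj) enum_valK.
Qed.

Lemma index_leq A B N M : subgroup B -> has_index A B N -> has_index A B M -> (N <= M)%N.
Proof.
move=> gB [r [rA rB]] [s [sA sB]].
have /fin_all_exists[f fP] i : exists j, B (r i - s j).
  by have [j [Bj _]] := sB _ (rA i); exists j.
suff /leq_card : injective f by rewrite !card_ord.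
move=> i j E; have := fP i; rewrite E => Bi; have := fP j => Bj.
have [k [_ uk]] := rB _ (rA i).
rewrite -(uk i); last by rewrite subrr; case: gB.
apply: uk; rewrite (_ : _ - _ = (r i - s (f j)) - (r j - s (f j))); last by ring.
exact: (proj2 gB).
Qed.

Lemma index_unique A B N M : subgroup B -> has_index A B N -> has_index A B M -> N = M.
Proof.
by move=> gB h h'; apply/eqP; rewrite eqn_leq !(index_leq gB h, index_leq gB h').
Qed.

Lemma index_gt0 A B N : A 0 -> has_index A B N -> (0 < N)%N.
Proof. by move=> A0 [r [_ rB]]; have [[m hm] _] := rB _ A0; apply: leq_trans hm. Qed.

Lemma index_tower A B D N M : subgroup A -> subgroup B -> included B A -> included D B ->
  has_index A B N -> has_index B D M -> has_index A D (N * M).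
Proof.
move=> gA gB BA DB [r [rA rB]] [s [sB sD]].
rewrite -{1}(card_ord N) -{1}(card_ord M) -card_prod.
apply: (@index_finType _ (fun ij => r ij.1 + s ij.2)) => [[i j]|x Ax] /=.
  by apply: subgroupD => //; apply: BA.
have [i [Bi ui]] := rB _ Ax; have [j [Dj uj]] := sD _ Bi.
exists (i, j); split=> [|[i' j'] /=]; first by rewrite opprD addrA.
rewrite opprD addrA => Dj'.
have Ei : i = i'.
  apply: ui; rewrite -[_ - _](subrK (s j')); apply: subgroupD => //.
  exact: DB.
by rewrite -Ei in Dj' *; rewrite (uj _ Dj').
Qed.

Lemma index_dilate a A B N : a != 0 -> has_index A B N ->
  has_index (dilate a A) (dilate a B) N.
Proof.
move=> a0 [r [rA rB]]; exists (fun i => a * r i); split=> [i|_ [y Ay ->]].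
  by exists (r i).
have [i [Bi ui]] := rB _ Ay; exists i; split=> [|j [z Bz]].
  by exists (y - r i); rewrite ?mulrBr.
by rewrite -mulrBr => /(mulfI a0) E; apply: ui; rewrite E.
Qed.

(** The cosets of D that meet B are the cosets of D in B; choosing one
    representative [c i] in each class modulo B of the representatives [r i] of
    A / D gives the cosets of B in A. *)
Lemma index_intermediate A B D N : subgroup A -> subgroup B -> subgroup D ->
    included D B -> included B A -> has_index A D N ->
  (exists M, has_index A B M) /\ (exists M, has_index B D M).
Proof.
move=> gA gB gD DB BA [r [rA rD]].
have Br x i : D (x - r i) -> B x -> B (r i).
  move=> h Bx; rewrite -[r i](subKr x); apply: (proj2 gB) => //; exact: DB.
pose e i j := classicb (B (r i - r j)).
have eP i j : reflect (B (r i - r j)) (e i j) by apply: classicP.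
pose m i := classicb (B (r i)).
have mP i : reflect (B (r i)) (m i) by apply: classicP.
split; last first.
  exists #|{: {i | m i}}|; apply: (@index_finType _ (fun i => r (sval i))).
    by move=> [i mi] /=; apply/mP.
  move=> x Bx; have [i [Di ui]] := rD _ (BA _ Bx).
  have /mP mi := Br _ _ Di Bx.
  exists (exist _ i mi); split=> // -[j mj] /= /ui E.
  by apply: val_inj.
have eR i : e i i by apply/eP; rewrite subrr; case: gB.
have eS i j : e i j -> e j i by move=> /eP h; apply/eP; rewrite -opprB; apply: subgroupN.
have eT i j k : e i j -> e j k -> e i k.
  move=> /eP h /eP h'; apply/eP; rewrite -[_ - r k](subrKA (r j)).
  exact: subgroupD.
pose c i := odflt i [pick j | e i j].
have ce i : e i (c i) by rewrite /c; case: pickP => //= /(_ i); rewrite eR.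
have cc i j : e i j -> c i = c j.
  move=> eij; have E : e i =1 e j.
    by move=> k; apply/idP/idP; apply: eT => //; apply: eS.
  by rewrite /c (eq_pick E); case: pickP => //= /(_ j); rewrite eR.
exists #|{: {i | c i == i}}|; apply: (@index_finType _ (fun i => r (sval i))).
  by move=> [i ci]; apply: rA.
move=> x Ax; have [i [Di ui]] := rD _ Ax.
have cic : c (c i) == c i by rewrite -(cc _ _ (ce i)).
exists (exist _ (c i) cic); split=> /=.
  rewrite -[_ - _](subrKA (r i)); apply: subgroupD => //; first exact: DB.
  by apply/eP/ce.
move=> [j cj] /= Bj; apply: val_inj => /=; rewrite -(eqP cj).
apply: cc; apply/eP.
rewrite (_ : _ - _ = (x - r j) - (x - r i)); last by ring.
by apply: (proj2 gB) => //; apply: DB.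
Qed.

End Index.

(** * The ring of integers as a lattice *)

Section Integers.
Variable K : fieldExtType rat.
Local Notation O := (@OK K).

Lemma OK_int (m : int) : O m%:~R.
Proof. exact: (integral_id (intr : {rmorphism int -> K})). Qed.

Lemma OK_nat (m : nat) : O m%:R. Proof. exact: (OK_int m). Qed.

Lemma OK0 : O 0. Proof. exact: (OK_int 0). Qed.

Lemma OK1 : O 1. Proof. exact: (OK_int 1). Qed.

Lemma OKD x y : O x -> O y -> O (x + y). Proof. exact: integral_add. Qed.

Lemma OKB x y : O x -> O y -> O (x - y). Proof. exact: integral_sub. Qed.

Lemma OKM x y : O x -> O y -> O (x * y). Proof. exact: integral_mul. Qed.

Lemma OKN x : O x -> O (- x). Proof. exact: integral_opp. Qed.

Lemma OKX x m : O x -> O (x ^+ m).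
Proof. by move=> Ox; elim: m => [|m IH]; rewrite ?expr0 ?exprS; [apply: OK1 | apply: OKM]. Qed.

Lemma OKMz x m : O x -> O (x *~ m).
Proof. by move=> Ox; rewrite -mulrzr; apply: OKM => //; apply: OK_int. Qed.

Lemma OK_sum (I : Type) (r : seq I) (P : pred I) (F : I -> K) :
  (forall i, P i -> O (F i)) -> O (\sum_(i <- r | P i) F i).
Proof. by move=> h; elim/big_ind: _ => //; [apply: OK0 | apply: OKD]. Qed.

Lemma OK_subgroup : subgroup O.
Proof. by split; [apply: OK0 | apply: OKB]. Qed.

Lemma OK_horner (g : {poly int}) x : O x -> O (map_poly intr g).[x].
Proof.
move=> Ox; rewrite horner_coef; apply: OK_sum => i _; apply: OKM; last exact: OKX.
by rewrite coef_map; apply: OK_int.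
Qed.

Lemma nat_neq0 m : (0 < m)%N -> m%:R != 0 :> K.
Proof.
move=> m0; have -> : m%:R = (m%:R : rat)%:A :> K by rewrite scaler_nat.
by rewrite scaler_eq0 oner_eq0 orbF pnatr_eq0 -lt0n.
Qed.

(** A nonzero integer divides the constant term of its equation, once the powers
    of X have been removed from this equation. *)
Lemma OK_dvd_nat a : O a -> a != 0 ->
  exists2 m : nat, (0 < m)%N & exists2 t, O t & m%:R = a * t.
Proof.
move=> Oa a0; have [g mg rg] := Oa.
suff [m m0 [t Ot E]] : exists2 m : int, m != 0 & exists2 t, O t & m%:~R = a * t.
  exists `|m|%N; first by rewrite lt0n absz_eq0.
  rewrite pmulrn abszE; case: (ger0P m) => _; first by exists t.
  by exists (- t); rewrite ?rmorphN /= ?E ?mulrN //; apply: OKN.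
have := monic_neq0 mg; move: (size g) {-2}g (leqnn (size g)) rg => s {g mg}.
elim: s => [|s IH] g.
  by rewrite leqn0 size_poly_eq0 => /eqP -> _; rewrite eqxx.
elim/poly_ind: g => [|g c _]; first by rewrite eqxx.
move=> sg rg g0; have [c0|c0] := eqVneq c 0.
  move: sg rg g0; rewrite c0 addr0; have [->|g0] := eqVneq g 0; first by rewrite mul0r eqxx.
  rewrite size_mulX // ltnS => sg; rewrite rmorphM /= map_polyX rootM rootX (negbTE a0) orbF.
  move=> rg _; exact: (IH g sg rg g0).
move: rg; rewrite /root rmorphD rmorphM /= map_polyX map_polyC /= !hornerE => /eqP E.
exists (- c); first by rewrite oppr_eq0.
exists (map_poly intr g).[a]; first exact: OK_horner.
by apply/eqP; rewrite rmorphN /= eq_sym -addr_eq0 mulrC E.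
Qed.

Definition ideal_like (A : K -> Prop) : Prop :=
  [/\ A 0, forall x y, A x -> A y -> A (x + y) & forall c x, O c -> A x -> A (c * x)].

Lemma ideal_subgroup A : ideal_like A -> subgroup A.
Proof.
move=> [A0 AD AM]; split=> // x y Ax Ay; apply: AD => //.
by rewrite -mulN1r; apply: AM => //; apply: OKN OK1.
Qed.

Lemma OK_ideal : ideal_like O.
Proof. by split; [apply: OK0 | apply: OKD | apply: OKM]. Qed.

Lemma ideal_norm_index A N : subgroup A -> has_index O A N -> ideal_norm A = N.
Proof.
move=> gA h; rewrite /ideal_norm; set P := (fun N => _).
have : P (epsilon (inhabits 0%N) P) by apply: epsilon_spec; exists N.
by move=> h'; apply: index_unique gA _ h.
Qed.

Variables (n p : nat) (b : 'I_n -> K).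
Hypotheses (pp : prime p) (hb : integral_basis b).

Lemma basis_eq (c d : 'I_n -> int) :
  \sum_i b i *~ c i = \sum_i b i *~ d i -> c =1 d.
Proof.
have [bO bU] := hb; move=> E i.
have Ox : O (\sum_i b i *~ c i) by apply: OK_sum => j _; apply: OKMz.
have [e [_ ue]] := bU _ Ox.
have ec : e = finfun c by apply: ue; apply: eq_bigr => j _; rewrite ffunE.
have ed : e = finfun d by apply: ue; rewrite E; apply: eq_bigr => j _; rewrite ffunE.
have /ffunP/(_ i) : finfun c = finfun d by rewrite -ec.
by rewrite !ffunE.
Qed.

Lemma basis_coord x : O x -> exists c : 'I_n -> int, x = \sum_i b i *~ c i.
Proof. by move=> Ox; have [e [E _]] := (proj2 hb) _ Ox; exists e. Qed.

Lemma index_nat m : (0 < m)%N -> has_index O (dilate m%:R O) (m ^ n).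
Proof.
move=> m0; have [bO _] := hb.
have -> : (m ^ n = #|{ffun 'I_n -> 'I_m}|)%N by rewrite card_ffun !card_ord.
apply: (@index_finType _ _ (fun c : {ffun 'I_n -> 'I_m} => \sum_i b i *~ c i)) => [c|x Ox].
  by apply: OK_sum => j _; apply: OKMz.
have [z ->] := basis_coord Ox.
have zm i : (`|(z i %% m)%Z| < m)%N.
  by rewrite -ltz_nat gez0_abs ?modz_ge0 ?ltz_pmod // gt_eqF.
exists [ffun i => Ordinal (zm i)]; split.
  exists (\sum_i b i *~ (z i %/ m)%Z).
    by apply: OK_sum => j _; apply: OKMz.
  rewrite -sumrB mulr_sumr; apply: eq_bigr => i _.
  rewrite ffunE /= -mulrzBr gez0_abs ?modz_ge0 ?gt_eqF // {1}(divz_eq (z i) m) addrK.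
  by rewrite mulrzA mulr_natl.
move=> c [y Oy]; have [t ->] := basis_coord Oy => E.
apply/ffunP => i; apply: val_inj; rewrite ffunE /=.
have Ez : z =1 (fun i => (t i * m + c i)%R).
  apply: basis_eq; move/eqP: E; rewrite subr_eq => /eqP ->.
  rewrite mulr_sumr -big_split /=; apply: eq_bigr => j _.
  by rewrite mulrzDr mulrzA mulr_natl.
by rewrite Ez modzMDl modz_small ?absz_nat // ltz_nat ltn_ord.
Qed.

(** Since [O : sO] = s^n and [O : A] = [sO : sA], the index of [sA] in [A] is
    [s^n]; the index of [B], which lies between [sA] and [A], divides it. *)
Lemma index_dilate_coprime A B s M : subgroup A -> subgroup B -> included A O ->
    included B A -> (0 < s)%N -> included (dilate s%:R A) B -> has_index O A M ->
  exists2 N, has_index A B N & (N %| s ^ n)%N.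
Proof.
move=> gA gB AO BA s0 sAB iA.
have gO := OK_subgroup; have s0K := nat_neq0 s0.
have gsO := subgroup_dilate s%:R gO; have gsA := subgroup_dilate s%:R gA.
have i1 := index_nat s0; have i2 := index_dilate s0K iA.
have sOO : included (dilate s%:R O) O.
  by move=> _ [y Oy ->]; apply: OKM => //; apply: OK_nat.
have sAsO : included (dilate s%:R A) (dilate s%:R O).
  by move=> _ [y Oy ->]; exists y; first exact: AO.
have i3 := index_tower gO gsO sOO sAsO i1 i2.
have sAA : included (dilate s%:R A) A by move=> x h; apply: BA; apply: sAB.
have [_ [L iL]] := index_intermediate gO gA gsA sAA AO i3.
have E : (M * L = s ^ n * M)%N.
  exact: index_unique gsA (index_tower gO gA AO sAA iA iL) i3.
have M0 : (0 < M)%N by apply: index_gt0 iA; apply: OK0.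
have {E}E : L = (s ^ n)%N by apply/eqP; rewrite -(eqn_pmul2l M0) E mulnC.
rewrite {}E in iL.
have [[N iN] [N' iN']] := index_intermediate gA gB gsA sAB BA iL.
exists N => //; apply/dvdnP; exists N'; rewrite mulnC.
exact: index_unique gsA iL (index_tower gA gB BA sAB iN iN').
Qed.

Lemma logn_coprime_exp s N : coprime p s -> (N %| s ^ n)%N -> (0 < s)%N -> logn p N = 0%N.
Proof.
move=> cps Ns s0; apply: logn_coprime; apply: (coprime_dvdr Ns).
by rewrite coprimeXr.
Qed.

(** Both indices can be compared with that of [sA], which differs from each of
    them by a factor prime to [p]. *)
Lemma index_commensurable A B s M : subgroup A -> subgroup B ->
    included A O -> included B O -> (0 < s)%N -> coprime p s ->
    (forall x, A x -> B (s%:R * x)) -> (forall x, B x -> A (s%:R * x)) ->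
    has_index O A M ->
  exists2 N, has_index O B N & logn p N = logn p M.
Proof.
move=> gA gB AO BO s0 cps AB BA iA.
have gO := OK_subgroup.
pose C := dilate s%:R A; have gC : subgroup C := subgroup_dilate _ gA.
have CA : included C A.
  move=> _ [y Ay ->]; rewrite -mulr_natl mulr_natl; elim: (s) => [|m IH].
    by rewrite mul0r; case: gA.
  by rewrite -addn1 natrD mulrDl mul1r; apply: subgroupD.
have CB : included C B by move=> _ [y Ay ->]; apply: AB.
have [N iN sN] := index_dilate_coprime gA gC AO CA s0 (fun x h => h) iA.
have iC := index_tower gO gA AO CA iA iN.
have [[N' iN'] _] := index_intermediate gO gB gC CB BO iC.
exists N' => //.
have ss0 : (0 < s * s)%N by rewrite muln_gt0 s0.
have ssB : included (dilate (s * s)%:R B) C.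
  by move=> _ [y By ->]; exists (s%:R * y); [apply: BA | rewrite natrM mulrA].
have [N2 iN2 sN2] := index_dilate_coprime gB gC BO CB ss0 ssB iN'.
have E := index_unique gC iC (index_tower gO gB BO CB iN' iN2).
have p0 X Y Z : has_index X Y Z -> X 0 -> (0 < Z)%N by move=> h h'; apply: index_gt0 h' h.
have := congr1 (logn p) E; rewrite !lognM; try by [
  apply: p0 iA OK0 | apply: p0 iN (proj1 gA) | apply: p0 iN' OK0 | apply: p0 iN2 (proj1 gB)].
by rewrite (logn_coprime_exp cps sN) // (logn_coprime_exp _ sN2) ?coprimeMr ?cps // !addn0.
Qed.

Lemma index_principal a : O a -> a != 0 -> exists N, has_index O (dilate a O) N.
Proof.
move=> Oa a0; have [m m0 [t Ot E]] := OK_dvd_nat Oa a0.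
have gO := OK_subgroup.
have [] := @index_intermediate _ O (dilate a O) (dilate m%:R O) (m ^ n) => //.
- exact: subgroup_dilate.
- exact: subgroup_dilate.
- by move=> _ [y Oy ->]; exists (t * y); [apply: OKM | rewrite E mulrA].
- by move=> _ [y Oy ->]; apply: OKM.
- exact: index_nat.
Qed.

(** The [p]-adic valuation of the absolute norm of [a], as the index of [a O]. *)
Definition pval (a : K) : nat := logn p (ideal_norm (dilate a O)).

Lemma pvalE a N : has_index O (dilate a O) N -> pval a = logn p N.
Proof.
by move=> h; rewrite /pval (ideal_norm_index _ h) //; apply/subgroup_dilate/OK_subgroup.
Qed.

(** The chain [O, a O, a c O] has steps of index N(a) and N(c), the second because
    multiplication by [a] maps O / c O onto a O / a c O. *)
Lemma pvalM a c : O a -> O c -> a != 0 -> c != 0 -> pval (a * c) = (pval a + pval c)%N.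
Proof.
move=> Oa Oc a0 c0.
have [N iN] := index_principal Oa a0; have [M iM] := index_principal Oc c0.
have gO := OK_subgroup.
have h : has_index O (dilate (a * c) O) (N * M).
  apply: (index_tower gO (subgroup_dilate a gO)) iN _.
  - by move=> _ [y Oy ->]; apply: OKM.
  - by move=> _ [y Oy ->]; exists (c * y); rewrite ?mulrA //; apply: OKM.
  have [r [rA rB]] := index_dilate a0 iM; exists r; split=> // x /rB[i [[y [z Oz ->] Ey] ui]].
  have sub y' : dilate a (dilate c O) y' <-> dilate (a * c) O y'.
    split=> [[_ [z' Oz' ->] ->]|[z' Oz' ->]]; first by exists z'; rewrite ?mulrA.
    by exists (c * z'); rewrite ?mulrA //; exists z'.
  by exists i; split=> [|j /sub/ui //]; apply/sub; exists (c * z) => //; exists z.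
by rewrite (pvalE h) (pvalE iN) (pvalE iM) lognM //; apply: index_gt0 OK0 _; eassumption.
Qed.

Lemma pval_coprime s : (0 < s)%N -> coprime p s -> pval s%:R = 0%N.
Proof. by move=> s0 cps; rewrite (pvalE (index_nat s0)) (logn_coprime_exp cps). Qed.

(** * Fractional ideals that are principal at p *)

(** The equality of A and [g O] after inversion of the integers prime to [p].  A
    single denominator [s] serves for all of A: this uniformity is what makes the
    notion stable under [idinv]. *)
Definition loc_gen (A : K -> Prop) (g : K) : Prop :=
  exists s : nat, [/\ (0 < s)%N, coprime p s,
    forall y, A y -> exists2 t, O t & s%:R * y = g * t & A (s%:R * g)].

(** The extension of [pval] to quotients of integers, as a relation. *)
Definition has_val (g : K) (z : int) : Prop :=
  exists a c, [/\ O a, O c, a != 0 & c != 0] /\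
    (g * c = a /\ z = (pval a)%:Z - (pval c)%:Z).

Definition loc_principal (A : K -> Prop) (z : int) : Prop :=
  ideal_like A /\ exists2 g, g != 0 & loc_gen A g /\ has_val g z.

Lemma has_val_int a : O a -> a != 0 -> has_val a (pval a).
Proof.
move=> Oa a0; exists a, 1; split; first by split; rewrite ?oner_neq0 //; apply: OK1.
by rewrite mulr1; split=> //; rewrite (pval_coprime (s := 1)) ?coprimen1 // subr0.
Qed.

Lemma has_valM g h y z : has_val g y -> has_val h z -> has_val (g * h) (y + z).
Proof.
move=> [a [c [[Oa Oc a0 c0] [E ->]]]] [a' [c' [[Oa' Oc' a'0 c'0] [E' ->]]]].
exists (a * a'), (c * c'); split; first by split; rewrite ?mulf_neq0 //; apply: OKM.
split; first by rewrite mulrACA E E'.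
by rewrite !pvalM // !PoszD; ring.
Qed.

Lemma has_valV g z : g != 0 -> has_val g z -> has_val g^-1 (- z).
Proof.
move=> g0 [a [c [[Oa Oc a0 c0] [E ->]]]].
by exists c, a; split=> //; rewrite opprB; split=> //; rewrite -E mulKf.
Qed.

Lemma loc_principal_OK : loc_principal O 0.
Proof.
split; first exact: OK_ideal.
exists 1; rewrite ?oner_neq0 //; split.
  exists 1%N; rewrite coprimen1; split=> // [y Oy|]; last by rewrite mulr1; apply: OK1.
  by exists y.
by have := has_val_int OK1 (oner_neq0 _); rewrite (pval_coprime (s := 1)) ?coprimen1.
Qed.

Lemma idmul_ideal A B : ideal_like A -> ideal_like B -> ideal_like (idmul A B).
Proof.
move=> [A0 AD AM] [B0 BD BM]; split.
- by exists 0%N, (fun=> 0), (fun=> 0); split=> [[]|[]|] //; rewrite big_ord0.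
- move=> x y [m [a [c [Aa Bc ->]]]] [m' [a' [c' [Aa' Bc' ->]]]].
  pose join (f : 'I_m -> K) (f' : 'I_m' -> K) (i : 'I_(m + m')) :=
    match split i with inl j => f j | inr j => f' j end.
  have joinl f f' j : join f f' (lshift m' j) = f j.
    by rewrite /join -[lshift _ _]/(unsplit (inl j)) unsplitK.
  have joinr f f' j : join f f' (rshift m j) = f' j.
    by rewrite /join -[rshift _ _]/(unsplit (inr j)) unsplitK.
  exists (m + m')%N, (join a a'), (join c c'); split=> [i|i|].
  + by rewrite /join; case: (split i).
  + by rewrite /join; case: (split i).
  rewrite big_split_ord /=.
  by congr (_ + _); apply: eq_bigr => i _; rewrite ?joinl ?joinr.
move=> e x Oe [m [a [c [Aa Bc ->]]]].
exists m, (fun i => e * a i), c; split=> // [i|]; first exact: AM.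
by rewrite mulr_sumr; apply: eq_bigr => i _; rewrite mulrA.
Qed.

Lemma loc_principalM A B y z : loc_principal A y -> loc_principal B z ->
  loc_principal (idmul A B) (y + z).
Proof.
move=> [iA [g g0 [[s [s0 cs sA As]] vg]]] [iB [h h0 [[t [t0 ct tB Bt]] vh]]].
split; first exact: idmul_ideal.
exists (g * h); first by rewrite mulf_neq0.
split; last exact: has_valM.
exists (s * t)%N; rewrite muln_gt0 s0 t0 coprimeMr cs ct; split=> //.
  move=> x [m [a [c [Aa Bc ->]]]].
  have /fin_all_exists[u uP] i : exists u, O u /\ s%:R * a i = g * u.
    by have [u] := sA _ (Aa i); exists u.
  have /fin_all_exists[v vP] i : exists v, O v /\ t%:R * c i = h * v.
    by have [v] := tB _ (Bc i); exists v.
  exists (\sum_i u i * v i).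
    by apply: OK_sum => i _; apply: OKM; [case: (uP i) | case: (vP i)].
  rewrite !mulr_sumr; apply: eq_bigr => i _.
  by rewrite natrM mulrACA (proj2 (uP i)) (proj2 (vP i)) mulrACA.
exists 1%N, (fun=> s%:R * g), (fun=> t%:R * h); split=> //.
by rewrite big_ord1 natrM mulrACA.
Qed.

(** If [s A] lies in [g O] and [s g] in A, then [s g^-1 A] lies in O, and
    [y A] in O forces [s g y] in O. *)
Lemma loc_principalV A z : loc_principal A z -> loc_principal (idinv A) (- z).
Proof.
move=> [[A0 AD AM] [g g0 [[s [s0 cs sA As]] vg]]]; split.
  split=> [y Ay|x y hx hy u Au|c x Oc hx u Au]; first by rewrite mul0r; apply: OK0.
    by rewrite mulrDl; apply: OKD; [apply: hx | apply: hy].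
  by rewrite -mulrA; apply: OKM => //; apply: hx.
exists g^-1; first by rewrite invr_eq0.
split; last exact: has_valV.
exists s; split=> // [y hy|y Ay].
  exists (y * (s%:R * g)); first exact: hy.
  by field.
have [t Ot E] := sA _ Ay.
by rewrite mulrAC E mulrAC mulfV ?mul1r.
Qed.

Lemma loc_principalX A z (k : int) : loc_principal A z ->
  loc_principal (idexp A k) (k * z).
Proof.
have hX B y m : loc_principal B y -> loc_principal (iter m (idmul B) O) (m%:Z * y).
  move=> hB; elim: m => [|m IH]; first by rewrite mul0r; apply: loc_principal_OK.
  rewrite iterS -add1n PoszD mulrDl mul1r; exact: loc_principalM.
case: k => m hA; first exact: hX.
by rewrite NegzE mulNr -mulrN; apply/hX/loc_principalV.
Qed.

Lemma padic_val_quo N M : (0 < N)%N -> (0 < M)%N ->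
  padic_val p (N%:R / M%:R) = (logn p N)%:Z - (logn p M)%:Z.
Proof.
move=> N0 M0; rewrite /padic_val; set q := N%:R / M%:R : rat.
have M0' : M%:R != 0 :> rat by rewrite pnatr_eq0 -lt0n.
have q0 : q != 0 by rewrite mulf_neq0 ?invr_eq0 // pnatr_eq0 -lt0n.
have E : (`|numq q| * M = N * `|denq q|)%N.
  have q_ge0 : 0 <= q by rewrite divr_ge0 ?ler0n.
  apply/eqP; rewrite -eqz_nat !PoszM !abszE [`|denq q|]gtr0_norm ?denq_gt0 //.
  rewrite ger0_norm ?numq_ge0 // -(inj_eq (intr_inj (R := rat))) !intrM numqE.
  by rewrite /q mulrAC divfK.
have := congr1 (logn p) E; rewrite !lognM ?absz_gt0 ?numq_eq0 ?denq_eq0 //.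
lia.
Qed.

(** Let [g = b1 / c] be the local generator and [e = a s g], an element of [a A].
    Then [e O] and [a A] are commensurable up to integers prime to [p], and
    [e c = a s b1], where [s] has valuation 0. *)
Lemma loc_principal_norm A z : loc_principal A z ->
  padic_val p (frac_ideal_norm A) = z.
Proof.
move=> [iA [g g0 [[s [s0 cs sA As]] [b1 [c [[Ob Oc b0 c0] [Eg ->]]]]]]].
have gO := OK_subgroup; have sK := nat_neq0 s0.
rewrite /frac_ideal_norm; set P := (fun q : rat => _).
have : P (epsilon (inhabits 0) P).
  apply: epsilon_spec; eexists; exists (s%:R * c); split; last by [].
  - by rewrite mulf_neq0.
  - by apply: OKM => //; apply: OK_nat.
  move=> y /sA[t Ot E]; rewrite mulrAC E [g * t]mulrC -mulrA Eg.
  exact: OKM.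
set q := epsilon _ _ => -[a [a0 Oa aA ->]].
rewrite -/(dilate a A) -/(dilate a O).
pose e := a * (s%:R * g).
have Oe : O e by apply: aA.
have e0 : e != 0 by rewrite !mulf_neq0.
have [Ne iNe] := index_principal Oe e0.
have [Na iNa] := index_principal Oa a0.
have aAO : included (dilate a A) O by move=> _ [y Ay ->]; apply: aA.
have [N iN EN] : exists2 N, has_index O (dilate a A) N & logn p N = logn p Ne.
  have ss0 : (0 < s * s)%N by rewrite muln_gt0 s0.
  have css : coprime p (s * s) by rewrite coprimeMr cs.
  apply: (index_commensurable (A := dilate e O) (s := (s * s)%N)) iNe => //.
  - exact: subgroup_dilate.
  - by apply/subgroup_dilate/ideal_subgroup.
  - by move=> _ [y Oy ->]; apply: OKM.
  - move=> _ [y Oy ->]; exists ((s * s)%:R * y * (s%:R * g)).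
      by case: iA => _ _ AM; apply: AM => //; apply: OKM => //; apply: OK_nat.
    by rewrite /e; ring.
  - move=> _ [y Ay ->]; have [t Ot E] := sA _ Ay; exists t => //.
    by rewrite natrM /e -!mulrA [s%:R * (a * y)]mulrCA E; ring.
have p0 X Z : has_index O X Z -> (0 < Z)%N by apply: index_gt0; apply: OK0.
rewrite (ideal_norm_index _ iN); last by apply/subgroup_dilate/ideal_subgroup.
rewrite (ideal_norm_index _ iNa); last exact: subgroup_dilate.
rewrite padic_val_quo ?(p0 _ _ iN) ?(p0 _ _ iNa) // EN -(pvalE iNe) -(pvalE iNa).
have Os := OK_nat s.
have Eec : e * c = a * s%:R * b1 by rewrite /e -Eg; ring.
move: (e) Eec Oe e0 iNe => {}e Eec Oe e0 iNe; move/(congr1 pval): Eec.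
rewrite !pvalM ?mulf_neq0 //; last exact: OKM.
by rewrite (pval_coprime s0) // => h; lia.
Qed.

End Integers.

(** * Integer polynomials modulo p *)

Section ReductionModP.
Variable p : nat.
Hypothesis pp : prime p.

Definition red (g : {poly int}) : {poly 'F_p} := map_poly intr g.

(** A section of [red] that keeps the degree, with coefficients between 0 and
    [p - 1]. *)
Definition lift (P : {poly 'F_p}) : {poly int} :=
  map_poly (fun c : 'F_p => (c : nat)%:Z) P.

Lemma redD g h : red (g + h) = red g + red h. Proof. exact: rmorphD. Qed.
Lemma redB g h : red (g - h) = red g - red h. Proof. exact: rmorphB. Qed.
Lemma redM g h : red (g * h) = red g * red h. Proof. exact: rmorphM. Qed.

Lemma liftK P : red (lift P) = P.
Proof.
apply/polyP => i; rewrite /red coef_map /= coef_map_id0 //.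
by rewrite -[RHS]natr_Zp.
Qed.

Lemma size_lift P : size (lift P) = size P.
Proof. by apply: size_map_inj_poly => // a c [] /val_inj. Qed.

Lemma lift_monic P : P \is monic -> lift P \is monic.
Proof.
rewrite !monicE /lead_coef size_lift coef_map_id0 // => /eqP ->.
Qed.

Lemma intr_Fp_eq0 (c : int) : ((c%:~R : 'F_p) == 0) = (p %| c)%Z.
Proof. by rewrite (dvdz_pcharf (pchar_Fp pp)). Qed.

Lemma red_eq0 g : red g = 0 -> exists h : {poly int}, g = p%:Z *: h.
Proof.
move=> r0; exists (map_poly (fun c => c %/ p)%Z g).
apply/polyP => i; rewrite coefZ coef_map_id0 ?div0z //.
have : (p %| g`_i)%Z by rewrite -intr_Fp_eq0 -(coef_map intr) -/(red g) r0 coef0.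
by move=> /divzK {1}<-; rewrite mulrC.
Qed.

Lemma red_eq g h : red g = red h -> exists k, g = h + p%:Z *: k.
Proof.
move=> E; have [|k Ek] := @red_eq0 (g - h); first by rewrite redB E subrr.
by exists k; rewrite -Ek addrC subrK.
Qed.

Lemma red_pZ k : red (p%:Z *: k) = 0.
Proof.
apply/polyP => i; rewrite coef_map coefZ coef0 /=; apply/eqP.
by rewrite intr_Fp_eq0 dvdz_mulr.
Qed.

End ReductionModP.

(** * An integral element of index prime to p *)

Section Monogenic.
Variables (K : fieldExtType rat) (n p : nat) (eta : 'I_n -> K) (x : K) (a : 'M[int]_n).
Hypotheses (pp : prime p) (n0 : (0 < n)%N) (heta : integral_basis eta) (Ox : OK x)
  (ha : forall k : 'I_n, x ^+ k = \sum_i eta i *~ a i k)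
  (pNa : ~~ (p %| \det a)%Z).
Local Notation O := (@OK K).
Local Notation red := (red p).

Definition ev (y : K) (g : {poly int}) : K := (map_poly intr g).[y].

Lemma evD y g h : ev y (g + h) = ev y g + ev y h.
Proof. by rewrite /ev rmorphD hornerD. Qed.
Lemma evB y g h : ev y (g - h) = ev y g - ev y h.
Proof. by rewrite /ev rmorphB hornerD hornerN. Qed.
Lemma evN y g : ev y (- g) = - ev y g.
Proof. by rewrite /ev rmorphN hornerN. Qed.
Lemma evM y g h : ev y (g * h) = ev y g * ev y h.
Proof. by rewrite /ev rmorphM hornerM. Qed.
Lemma evZ y (c : int) g : ev y (c *: g) = c%:~R * ev y g.
Proof. by rewrite -mul_polyC evM /ev map_polyC hornerC. Qed.
Lemma ev1 y : ev y 1 = 1.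
Proof. by rewrite /ev rmorph1 hornerC. Qed.
Lemma ev0 y : ev y 0 = 0.
Proof. by rewrite /ev rmorph0 horner0. Qed.
Lemma evXn y m : ev y 'X^m = y ^+ m.
Proof. by rewrite /ev map_polyXn hornerXn. Qed.
Lemma evE y m (g : {poly int}) : (size g <= m)%N -> ev y g = \sum_(i < m) (g`_i)%:~R * y ^+ i.
Proof.
move=> sg; rewrite /ev (horner_coef_wide _ (n := m)); last first.
  by apply: leq_trans sg; apply: size_poly.
by apply: eq_bigr => i _; rewrite coef_map.
Qed.

Lemma OK_ev g : O (ev x g). Proof. exact: OK_horner. Qed.

(** The characteristic polynomial of the matrix of multiplication by [x]. *)
Lemma char_poly_root : exists f : {poly int}, [/\ f \is monic, size f = n.+1 & ev x f = 0].
Proof.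
have /fin_all_exists[m mP] j : exists c : 'I_n -> int, x * eta j = \sum_i eta i *~ c i.
  by apply: basis_coord heta _ _; apply: OKM => //; apply: (proj1 heta).
pose M : 'M[int]_n := \matrix_(i, j) m j i.
exists (char_poly M); split; [exact: char_poly_monic | exact: size_char_poly | ].
apply/eqP; rewrite -[_ == 0]/(root _ _) map_char_poly -eigenvalue_root_char.
apply/eigenvalueP; exists (\row_i eta i).
  apply/rowP => j; rewrite !mxE mP; apply: eq_bigr => i _.
  by rewrite !mxE mulrzr.
apply/eqP => /rowP E0; have [c Ec] := basis_coord heta (@OK1 K).
have := oner_neq0 K; rewrite Ec big1 ?eqxx // => i _.
by have := E0 i; rewrite !mxE => ->; rewrite mul0rz.
Qed.

(** Cramer's rule for the matrix of the powers of [x] in the integral basis. *)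
Lemma scaled_in_Zx : exists s : nat, [/\ (0 < s)%N, coprime p s &
  forall y, O y -> exists g, s%:R * y = ev x g].
Proof.
exists `|\det a|%N; split.
- by rewrite lt0n absz_eq0; apply: contraNneq pNa => ->; rewrite dvdz0.
- by rewrite prime_coprime.
move=> y Oy; have [c ->] := basis_coord heta Oy.
have E i : eta i *~ \det a = \sum_(k < n) x ^+ k *~ (\adj a) k i.
  under eq_bigr do rewrite ha mulrz_suml.
  rewrite exchange_big (bigD1 i) //= [X in _ + X]big1 => [|j ji].
    under eq_bigr do rewrite -mulrzA.
    rewrite -mulrz_sumr addr0; congr (_ *~ _).
    by have /matrixP/(_ i i) := mul_mx_adj a; rewrite !mxE eqxx mulr1n => <-.
  under eq_bigr do rewrite -mulrzA.
  have /matrixP/(_ j i) := mul_mx_adj a; rewrite !mxE (negbTE ji) mulr0n => E0.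
  by rewrite -mulrz_sumr E0 mulr0z.
pose g : {poly int} := \sum_(k < n) (\sum_i (\adj a) k i * c i) *: 'X^k.
have Eg : (\sum_i eta i *~ c i) * (\det a)%:~R = ev x g.
  rewrite mulrzr mulrz_suml /g (big_morph (ev x) (evD x) (ev0 x)).
  under [LHS]eq_bigr => i _ do rewrite -mulrzA mulrC mulrzA E mulrz_suml.
  rewrite exchange_big; apply: eq_bigr => k _.
  rewrite evZ evXn mulrC mulrzr mulrz_sumr; apply: eq_bigr => i _.
  by rewrite mulrzA.
have -> : (`|\det a|%N)%:R = `|\det a|%:~R :> K by rewrite pmulrn abszE.
rewrite mulrC in Eg.
case: (ger0P (\det a)) => _; first by exists g.
by exists (- g); rewrite rmorphN mulNr Eg evN.
Qed.

(** Modulo [p], every integer is a polynomial in [x], because the denominator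
    in [scaled_in_Zx] is invertible there. *)
Lemma in_Zx_modp y : O y -> exists g, exists2 t, O t & y = ev x g + p%:R * t.
Proof.
have [s [s0 cs sP]] := scaled_in_Zx => Oy; have [g Eg] := sP y Oy.
have [u [v E]] : exists u v : nat, (u * s = v * p + 1)%N.
  case: (egcdnP p s0) => u v E _; exists u, v.
  by rewrite E; move: cs; rewrite coprime_sym => /eqP ->.
exists (u%:Z *: g), (- (v%:R * y)); first by apply: OKN; apply: OKM => //; apply: OK_nat.
have := congr1 (fun m => m%:R * y) E; rewrite natrD !natrM => E'.
by rewrite evZ -Eg /= -pmulrn mulrA E'; ring.
Qed.

(** The powers [1, x, ..., x^(n-1)] are independent modulo [p], since [a] is
    invertible modulo [p]; apply this to the remainder of [g] modulo [f]. *)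
Lemma ev_in_p g t : O t -> ev x g = p%:R * t ->
  forall f, f \is monic -> size f = n.+1 -> ev x f = 0 -> red f %| red g.
Proof.
move=> Ot E f mf sf f0.
have Eg := Pdiv.RingMonic.rdivp_eq mf g.
set q := Pdiv.CommonRing.rdivp g f in Eg; set r := Pdiv.CommonRing.rmodp g f in Eg.
have sr : (size r <= n)%N by rewrite -ltnS -sf Pdiv.CommonRing.ltn_rmodp monic_neq0.
suff r0 : red r = 0 by rewrite Eg redD redM r0 addr0 dvdp_mull.
have Er : ev x r = p%:R * t by rewrite -E Eg evD evM f0 mulr0 add0r.
have [c Ec] := basis_coord heta Ot.
pose v := \col_(k < n) r`_k.
have Ev : a *m v = \col_i (p%:Z * c i).
  have /basis_eq-/(_ heta) E2 : \sum_i eta i *~ (\sum_(k < n) a i k * r`_k) =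
      \sum_i eta i *~ (p%:Z * c i).
    rewrite -[RHS](_ : ev x r = _); last first.
      rewrite Er Ec mulr_sumr; apply: eq_bigr => i _.
      by rewrite [p%:Z * _]mulrC mulrzA mulr_natl.
    rewrite (evE _ sr); under [RHS]eq_bigr do rewrite ha mulr_sumr.
    rewrite exchange_big; apply: eq_bigr => i _.
    rewrite mulrz_sumr; apply: eq_bigr => k _.
    by rewrite mulrzA mulrC mulrzr.
  by apply/colP => i; rewrite !mxE -E2; apply: eq_bigr => k _; rewrite !mxE.
apply/polyP => k; rewrite coef0 coef_map /=; apply/eqP.
have [kn|nk] := ltnP k n; last by rewrite nth_default ?(leq_trans sr) ?mulr0z.
have /matrixP/(_ (Ordinal kn) 0) : \adj a *m (a *m v) = \adj a *m \col_i (p%:Z * c i).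
  by rewrite Ev.
rewrite mulmxA mul_adj_mx mul_scalar_mx !mxE /= => Ek.
have : (p %| \det a * r`_k)%Z.
  by rewrite Ek; apply: rpred_sum => i _; rewrite !mxE mulrCA dvdz_mulr.
by rewrite -!(intr_Fp_eq0 pp) intrM mulf_eq0 intr_Fp_eq0 // (negbTE pNa).
Qed.

(** * Dedekind criterion and a local generator *)

Variable f : {poly int}.
Hypotheses (mf : f \is monic) (sf : size f = n.+1) (f0 : ev x f = 0).

Lemma size_red_f : size (red f) = n.+1.
Proof. by rewrite size_map_poly_id0 // (monicP mf) oner_neq0. Qed.

Lemma red_f_neq0 : red f != 0.
Proof. by rewrite -size_poly_eq0 size_red_f. Qed.

Lemma OK_quadratic c d y : O c -> O d -> y ^+ 2 + c * y + d = 0 -> O y.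
Proof.
move=> Oc Od E.
pose q : {poly K} := Poly [:: d; c; 1].
have Eq : q = [:: d; c; 1] :> seq K by apply: (@PolyK _ 0); apply: oner_neq0.
apply: (@integral_root_monic _ _ (intr : {rmorphism int -> K}) y q).
- by rewrite monicE /lead_coef Eq.
- by apply/eqP; rewrite -E horner_Poly /=; ring.
by move=> z; rewrite Eq !inE => /or3P[]/eqP-> //; apply: OK1.
Qed.

(** Let [q] be the gcd, and [g = g1 q + p g2], [h = h1 q + p h2],
    [k = k1 q + p k2].  Evaluating [f = g h + p k] at [x] shows that
    [y = (q g1 h1)(x) / p] is a root of the monic quadratic polynomial
    [Y^2 + (g1 h2 + g2 h1 + k1)(x) Y + ((g2 h2 + k2) g1 h1)(x)], so [y] is
    integral.  Hence [f] divides [q g1 h1] modulo [p], while [f = q^2 g1 h1], so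
    that [q] is constant. *)
Lemma dedekind (g h k : {poly int}) : f = g * h + p%:Z *: k ->
  coprimep (gcdp (red g) (red h)) (red k).
Proof.
move=> Ef; set P := gcdp (gcdp (red g) (red h)) (red k).
have Pg : P %| red g by rewrite (dvdp_trans (dvdp_gcdl _ _)) ?dvdp_gcdl.
have Ph : P %| red h by rewrite (dvdp_trans (dvdp_gcdl _ _)) ?dvdp_gcdr.
have Pk : P %| red k by rewrite dvdp_gcdr.
pose q := lift P; pose g1 := lift (red g %/ P); pose h1 := lift (red h %/ P).
pose k1 := lift (red k %/ P).
have [g2 Eg] : exists g2, g = g1 * q + p%:Z *: g2.
  by apply: (red_eq pp); rewrite redM !liftK // divpK.
have [h2 Eh] : exists h2, h = h1 * q + p%:Z *: h2.
  by apply: (red_eq pp); rewrite redM !liftK // divpK.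
have [k2 Ek] : exists k2, k = k1 * q + p%:Z *: k2.
  by apply: (red_eq pp); rewrite redM !liftK // divpK.
have pK : p%:R != 0 :> K by apply: nat_neq0; apply: prime_gt0.
pose y := ev x (q * g1 * h1) / p%:R.
have Ey : ev x (q * g1 * h1) = p%:R * y by rewrite /y [RHS]mulrC divfK.
have E0 : ev x g * ev x h + p%:R * ev x k = 0 by rewrite -f0 Ef evD evM evZ -pmulrn.
have Oy : O y.
  apply: (@OK_quadratic (ev x (g1 * h2 + g2 * h1 + k1))
                        (ev x ((g2 * h2 + k2) * (g1 * h1)))); try exact: OK_ev.
  rewrite Eg Eh Ek in E0; rewrite !(evD, evM, evZ) -!pmulrn in E0.
  rewrite /y !(evD, evM).
  set Q := ev x q in E0 *; set G1 := ev x g1 in E0 *; set H1 := ev x h1 in E0 *.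
  set G2 := ev x g2 in E0 *; set H2 := ev x h2 in E0 *; set K1 := ev x k1 in E0 *.
  set K2 := ev x k2 in E0 *; set r := p%:R in E0 pK *.
  (* The quadratic expression in y is f(x) g1(x) h1(x) / p^2. *)
  transitivity (((G1 * Q + r * G2) * (H1 * Q + r * H2) + r * (K1 * Q + r * K2))
                * (G1 * H1) / r ^+ 2).
    by field.
  by rewrite E0 !mul0r.
have := ev_in_p Oy Ey mf sf f0; rewrite !redM !liftK // Ef redD redM red_pZ // addr0.
rewrite -[in red g * red h](divpK Pg) -[in _ * red h](divpK Ph).
set G1 := red g %/ P; set H1 := red h %/ P.
have F0 : P * G1 * H1 != 0.
  have := red_f_neq0; rewrite Ef redD redM red_pZ // addr0 -(divpK Pg) -(divpK Ph).
  by apply: contraNneq; rewrite -/G1 -/H1 => E; rewrite [G1 * P]mulrC mulrA E mul0r.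
rewrite (_ : G1 * P * (H1 * P) = (P * G1 * H1) * P); last by ring.
by rewrite -[X in _ %| X]mulr1 dvdp_mul2l // dvdp1 /coprimep.
Qed.

(** For [al = g(x) + p c(x)] one has [al h(x) = p (c h - k)(x)].  Thus [p] is a
    multiple of [al], up to a factor 1 modulo [p], as soon as [c h - k] and [g] are
    coprime modulo [p].  The choice [c = g / gcd (g, k)] achieves this: since [g]
    is squarefree, an irreducible factor of [g] divides exactly one of [c] and
    gcd (g, k); in the first case it does not divide [k], in the second it divides
    [k] but neither [c] nor, by [dedekind], [h]. *)
Lemma local_generator (g h k : {poly int}) : f = g * h + p%:Z *: k ->
    separable_poly (red g) ->
  exists c A e : {poly int}, ev x (g + p%:Z *: c) * ev x A = p%:R * (1 + p%:R * ev x e).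
Proof.
move=> Ef sepg; have cop := dedekind Ef.
set E := gcdp (red g) (red k); set C := red g %/ E.
have Eg : red g = C * E by rewrite divpK // dvdp_gcdl.
have copCE : coprimep C E by move: sepg; rewrite Eg separable_mul => /and3P[].
have copt : coprimep (red g) (C * red h - red k).
  rewrite Eg coprimepMl; apply/andP; split; apply/coprimepP => d.
    move=> dC; rewrite dvdp_subr ?dvdp_mulr // => dk.
    move/coprimepP: copCE; apply=> //.
    by rewrite dvdp_gcd dk (dvdp_trans dC) // Eg dvdp_mulr.
  move=> dE; have dk : d %| red k by rewrite (dvdp_trans dE) ?dvdp_gcdr.
  rewrite dvdp_subl //.
  rewrite Gauss_dvdpr; last first.
    by rewrite coprimep_sym; apply: coprimep_dvdl dE _.
  move=> dh; move/coprimepP: cop; apply=> //.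
  by rewrite dvdp_gcd dh (dvdp_trans dE) ?dvdp_gcdl.
have [[U V] /= UV] := Bezout_eq1_coprimepP _ _ copt.
pose c := lift C; pose u := lift U; pose v := lift V.
have [m Em] : exists m, u * g + v * (c * h - k) = 1 + p%:Z *: m.
  by apply: (red_eq pp); rewrite redD !redM redB redM !liftK // UV /red rmorph1.
exists c, (p%:Z *: u + v * h), (m + u * c).
have := congr1 (ev x) Em; rewrite !(evD, evM, evN, evZ) ev1 -!pmulrn => Em'.
have E0 : ev x g * ev x h + p%:R * ev x k = 0 by rewrite -f0 Ef evD evM evZ -pmulrn.
transitivity (p%:R * (ev x u * ev x g + ev x v * (ev x c * ev x h - ev x k))
  + p%:R ^+ 2 * ev x u * ev x c + ev x v * (ev x g * ev x h + p%:R * ev x k)).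
  by ring.
by rewrite Em' E0; ring.
Qed.

(** An integer multiple of [1 + p e] stays one after removal of its factors [p],
    because [p] is invertible modulo [1 + p e]. *)
Lemma unit_dvd_nat e : O e -> 1 + p%:R * e != 0 ->
  exists s : nat, [/\ (0 < s)%N, coprime p s & exists2 t, O t & s%:R = (1 + p%:R * e) * t].
Proof.
move=> Oe u0; set u := 1 + _ in u0 *.
have Ou : O u by apply: OKD; [apply: OK1 | apply: OKM => //; apply: OK_nat].
have [m m0 [t Ot E]] := OK_dvd_nat Ou u0.
have [s cps Em] := pfactor_coprime pp m0; rewrite Em in E m0.
exists s; split=> //; first by move: m0; rewrite muln_gt0 => /andP[].
elim: (logn p m) t Ot E => [|j IH] t Ot E; first by exists t; rewrite -?E ?muln1.
apply: (IH ((s * p ^ j)%:R - e * t)).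
  by apply: OKB; [apply: OK_nat | apply: OKM].
have {}E : (s * p ^ j)%:R * p%:R = u * t by rewrite -E -natrM -mulnA -expnSr.
rewrite mulrBr mulrCA -E /u; ring.
Qed.

Definition pair_ideal (g y : K) : Prop :=
  exists s t, [/\ O s, O t & y = p%:R * s + g * t].

Lemma pair_ideal_ideal g : ideal_like (pair_ideal g).
Proof.
split.
- by exists 0, 0; rewrite !mulr0 addr0; split=> //; apply: OK0.
- move=> _ _ [s [t [Os Ot ->]]] [s' [t' [Os' Ot' ->]]].
  by exists (s + s'), (t + t'); split; [apply: OKD | apply: OKD | ring].
move=> c _ Oc [s [t [Os Ot ->]]].
by exists (c * s), (c * t); split; [apply: OKM | apply: OKM | ring].
Qed.

Lemma pair_idealP g y : O y -> pair_ideal g (p%:R * y).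
Proof. by move=> Oy; exists y, 0; rewrite mulr0 addr0; split=> //; apply: OK0. Qed.

Lemma pair_idealM g y : O y -> pair_ideal g (g * y).
Proof. by move=> Oy; exists 0, y; rewrite mulr0 add0r; split=> //; apply: OK0. Qed.

(** The quotient is F_p[X] / (g), with the remainders modulo [g] as
    representatives. *)
Lemma index_pair_ideal g : g \is monic -> red g %| red f ->
  has_index O (pair_ideal (ev x g)) (p ^ (size g).-1).
Proof.
move=> mg gf; set m := (size g).-1.
have sg : size g = m.+1 by rewrite /m prednK // lt0n size_poly_eq0 monic_neq0.
have mrg : red g \is monic by apply: monic_map.
have srg : size (red g) = m.+1 by rewrite size_map_poly_id0 // (monicP mg) oner_neq0.
have -> : (p ^ m = #|'rV['F_p]_m|)%N by rewrite card_mx card_Fp // mul1n.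
have [J0 JD JM] := pair_ideal_ideal (ev x g).
have JB : forall y z, pair_ideal (ev x g) y -> pair_ideal (ev x g) z -> pair_ideal (ev x g) (y - z).
  by case: (ideal_subgroup (pair_ideal_ideal (ev x g))).
apply: (@index_finType _ _ (fun v => ev x (lift (rVpoly v)))) => [v|y Oy]; first exact: OK_ev.
have [q [t Ot Ey]] := in_Zx_modp Oy.
pose v : 'rV['F_p]_m := poly_rV (red q %% red g).
have rv : rVpoly v = red q %% red g.
  by rewrite poly_rV_K // -ltnS -srg ltn_modp monic_neq0.
have Jv : pair_ideal (ev x g) (y - ev x (lift (rVpoly v))).
  have [k Ek] : exists k, q = lift (red q %/ red g) * g + lift (rVpoly v) + p%:Z *: k.
    by apply: (red_eq pp); rewrite redD redM !liftK // rv -divp_eq.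
  rewrite Ey [in ev x q]Ek !(evD, evM, evZ) -pmulrn.
  rewrite (_ : _ - _ = ev x g * ev x (lift (red q %/ red g)) + p%:R * (ev x k + t)); last by ring.
  apply: JD; first by apply: pair_idealM; apply: OK_ev.
  by apply: pair_idealP; apply: OKD => //; apply: OK_ev.
exists v; split=> // v' Jv'; apply: (can_inj rVpolyK).
have [s [u [Os Ou]]] : pair_ideal (ev x g) (ev x (lift (rVpoly v') - lift (rVpoly v))).
  rewrite evB (_ : _ - _ = (y - ev x (lift (rVpoly v))) -
                           (y - ev x (lift (rVpoly v')))); last by ring.
  exact: JB.
have [q' [t' Ot' ->]] := in_Zx_modp Ou => E.
have Ost : O (s + ev x g * t') by apply: OKD => //; apply: OKM => //; apply: OK_ev.
have := ev_in_p Ost (g := lift (rVpoly v') - lift (rVpoly v) - g * q') _ mf sf f0.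
rewrite evB E evM => /(_ _)/(dvdp_trans gf)-/(_ ltac:(ring)).
rewrite redB redB redM !liftK // dvdp_subl ?dvdp_mulr // => dv.
apply/eqP; rewrite eq_sym -subr_eq0; apply: contraTT dv => nz.
rewrite gtNdvdp // srg ltnS.
apply: leq_trans (size_polyD _ _) _; rewrite size_polyN geq_max.
by rewrite !size_poly.
Qed.

(** * Frobenius congruences modulo p *)

Definition congp (y z : K) : Prop := exists2 t, O t & y = z + p%:R * t.

Lemma congp_refl y : congp y y.
Proof. by exists 0; rewrite ?mulr0 ?addr0 //; apply: OK0. Qed.

Lemma congp_trans y z u : congp y z -> congp z u -> congp y u.
Proof. by move=> [t Ot ->] [s Os ->]; exists (s + t); [apply: OKD | ring]. Qed.

Lemma congpD y z y' z' : congp y z -> congp y' z' -> congp (y + y') (z + z').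
Proof. by move=> [t Ot ->] [s Os ->]; exists (t + s); [apply: OKD | ring]. Qed.

Lemma congpMr y z u : O u -> congp y z -> congp (y * u) (z * u).
Proof. by move=> Ou [t Ot ->]; exists (t * u); [apply: OKM | ring]. Qed.

Lemma frobenius1 y z : O y -> O z -> congp ((y + z) ^+ p) (y ^+ p + z ^+ p).
Proof.
move=> Oy Oz; rewrite /congp; case: p pp => // q pq; rewrite exprDn big_ord_recl big_ord_recr /=.
rewrite /bump /= !add1n subnn subn0 bin0 binn !expr0 mulr1 mul1r !mulr1n.
have /fin_all_exists[t tP] (i : 'I_q) : exists t, O t /\
    (y ^+ (q.+1 - bump 0 i) * z ^+ bump 0 i) *+ 'C(q.+1, bump 0 i) = q.+1%:R * t.
  have /dvdnP[c ->] : (q.+1 %| 'C(q.+1, bump 0 i))%N.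
    by apply: prime_dvd_bin => //; rewrite /bump /= add1n ltnS ltn_ord.
  exists ((y ^+ (q.+1 - bump 0 i) * z ^+ bump 0 i) * c%:R).
  by split; [apply: OKM (OK_nat _ _); apply: OKM; apply: OKX | rewrite -mulr_natr natrM; ring].
exists (\sum_i t i); first by apply: OK_sum => i _; case: (tP i).
under eq_bigr => i _ do rewrite (proj2 (tP i)).
by rewrite -mulr_sumr; ring.
Qed.

Lemma frobeniusD d y z : O y -> O z ->
  congp ((y + z) ^+ (p ^ d)) (y ^+ (p ^ d) + z ^+ (p ^ d)).
Proof.
move=> Oy Oz; elim: d => [|d [t Ot E]]; first exact: congp_refl.
rewrite expnSr !exprM E; set Y := y ^+ _; set Z := z ^+ _.
have [OY OZ] : O Y /\ O Z by split; apply: OKX.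
apply: congp_trans (frobenius1 (OKD OY OZ) (OKM (OK_nat _ p) Ot)) _.
rewrite -[Y ^+ p + _]addr0; apply: congpD; first exact: frobenius1.
rewrite /congp; case: p pp => // q _; exists ((q.+1%:R * t) ^+ q * t).
  by apply: OKM => //; apply: OKX; apply: OKM => //; apply: OK_nat.
by rewrite exprSr; ring.
Qed.

Lemma frobenius_sum d (I : Type) (r : seq I) (F : I -> K) : (forall i, O (F i)) ->
  congp ((\sum_(i <- r) F i) ^+ (p ^ d)) (\sum_(i <- r) F i ^+ (p ^ d)).
Proof.
move=> OF; elim: r => [|i r IH].
  by rewrite !big_nil expr0n expn_eq0 eqn0Ngt prime_gt0 //; apply: congp_refl.
rewrite !big_cons; apply: congp_trans (congpD (congp_refl _) IH).
by apply: frobeniusD => //; apply: OK_sum.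
Qed.

Lemma frobenius_int d (c : int) : congp (c%:~R ^+ (p ^ d)) c%:~R.
Proof.
have Q0 : (0 < p ^ d)%N by rewrite expn_gt0 prime_gt0.
have natP (m : nat) : congp (m%:R ^+ (p ^ d)) m%:R.
  elim: m => [|m IH]; first by rewrite expr0n eqn0Ngt Q0; apply: congp_refl.
  rewrite -addn1 natrD; apply: congp_trans (frobeniusD _ (OK_nat _ _) (@OK1 K)) _.
  by apply: congpD => //; rewrite expr1n; apply: congp_refl.
case: c => m; first exact: natP.
rewrite NegzE rmorphN /=; have [t Ot E] := natP m.+1.
have [s Os E'] := frobeniusD d (OK_nat K m.+1) (OKN (OK_nat K m.+1)).
exists (- s - t); first by apply: OKB => //; apply: OKN.
move: E'; rewrite subrr expr0n eqn0Ngt Q0 E -pmulrn => /eqP.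
rewrite eq_sym -subr_eq0 subr0 => /eqP E'.
by apply/eqP; rewrite -subr_eq0 -[X in _ == X]E'; apply/eqP; ring.
Qed.

(** Modulo [p], raising to the power [p^d] is additive and fixes the rational
    integers. *)
Lemma frobenius_comb d m (c : 'I_m -> int) (F : 'I_m -> K) : (forall i, O (F i)) ->
  congp ((\sum_i (c i)%:~R * F i) ^+ (p ^ d)) (\sum_i (c i)%:~R * F i ^+ (p ^ d)).
Proof.
move=> OF; apply: congp_trans (frobenius_sum _ _ _) _ => [i|].
  by apply: OKM => //; apply: OK_int.
elim: (index_enum _) => [|i r IH]; first by rewrite !big_nil; apply: congp_refl.
rewrite !big_cons; apply: congpD IH; rewrite exprMn.
by apply: congpMr (frobenius_int _ _); apply: OKX.
Qed.

(** Modulo [p], [y = h(x)] and [y^(p^d) = h(x^(p^d))], and [h(x^(p^d)) - h(x)]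
    is a multiple of [x^(p^d) - x]. *)
Lemma pair_ideal_frobenius d y : O y ->
  pair_ideal (x ^+ (p ^ d) - x) (y ^+ (p ^ d) - y).
Proof.
move=> Oy; set Q := (p ^ d)%N; have [J0 JD JM] := pair_ideal_ideal (x ^+ Q - x).
have [g [t Ot ->]] := in_Zx_modp Oy.
rewrite (evE x (leqnn (size g))); set S := \sum_(i < _) _.
have OS : O S by apply: OK_sum => i _; apply: OKM; [apply: OK_int | apply: OKX].
have [s Os E] := frobenius_comb d (fun i : 'I_(size g) => g`_i) (fun i => OKX i Ox).
have [u Ou E'] := frobeniusD d OS (OKM (OK_nat K p) Ot).
have [v Ov E2] : congp ((p%:R * t) ^+ Q) 0.
  have Q0 : (0 < Q)%N by rewrite expn_gt0 prime_gt0.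
  exists ((p%:R * t) ^+ Q.-1 * t).
    by apply: OKM => //; apply: OKX; apply: OKM => //; apply: OK_nat.
  by rewrite -{1}(prednK Q0) exprSr; ring.
rewrite E' E E2 -/Q.
set T := \sum_(i < _) _.
rewrite [X in pair_ideal _ X](_ : _ = p%:R * (s + v + u - t) + (T - S)); last by ring.
apply: (JD).
  by apply: pair_idealP; apply: OKB => //; apply: OKD => //; apply: OKD.
rewrite /T /S -sumrB; apply: (big_ind _ J0 JD) => i _.
rewrite -mulrBr -exprM mulnC exprM; apply: (JM); first exact: OK_int.
rewrite subrXX; apply: pair_idealM.
by apply: OK_sum => j _; apply: OKM; rewrite -?exprM; apply: OKX.
Qed.

(** * The ideals I_d at p *)

(** The only coefficients of [w_d - w_0] that may be nonzero are those of the
    [u_i]. *)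
Lemma idealIE (xi : 'I_n -> K) d y : idealI p xi d y <->
  exists2 c : 'I_n -> K, (forall i, O (c i)) & y = \sum_i c i * (xi i ^+ (p ^ d) - xi i).
Proof.
rewrite /idealI; set F := (w _ _ _ _ - _).
have FE m : F@_m = \sum_i (xi i ^+ (p ^ d) - xi i) * (U_(i)%MM == m)%:R.
  have -> : F = \sum_i (xi i ^+ (p ^ d) - xi i) *: 'X_i.
    rewrite /F /w -sumrB; apply: eq_bigr => i _.
    by rewrite expr1 -mulrBr -rmorphXn -rmorphB mulrC mul_mpolyC.
  by rewrite raddf_sum; apply: eq_bigr => i _ /=; rewrite mcoeffZ mcoeffX.
split=> [[c [Oc ->]]|[c Oc ->]].
  exists (fun i => \sum_(m <- msupp F) c m * (U_(i)%MM == m)%:R).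
    by move=> i; apply: OK_sum => m _; apply: OKM => //; apply: OK_nat.
  under eq_bigr do rewrite FE mulr_sumr.
  rewrite exchange_big; apply: eq_bigr => i _.
  by rewrite mulr_suml; apply: eq_bigr => m _; ring.
exists (fun m => \sum_i c i * (U_(i)%MM == m)%:R); split.
  by move=> m; apply: OK_sum => i _; apply: OKM => //; apply: OK_nat.
have E1 i : xi i ^+ (p ^ d) - xi i = F@_U_(i).
  rewrite FE (bigD1 i) //= eqxx mulr1 big1 ?addr0 // => j ji.
  by rewrite eq_mnm1 (negbTE ji) mulr0.
under eq_bigr do rewrite E1.
under [RHS]eq_bigr do rewrite mulr_suml.
rewrite exchange_big; apply: eq_bigr => i _ /=.
have [Ui|Ui] := boolP (U_(i)%MM \in msupp F).
  rewrite (bigD1_seq _ Ui) ?msupp_uniq //= eqxx mulr1 big1 ?addr0 // => m.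
  by rewrite eq_sym => /negbTE->; rewrite mulr0 mul0r.
rewrite (memN_msupp_eq0 Ui) mulr0 big1_seq // => m /andP[_ mF].
by case: eqP => [Em|_]; [rewrite Em mF in Ui | rewrite mulr0 mul0r].
Qed.

Lemma idealI_ideal (xi : 'I_n -> K) d : ideal_like (idealI p xi d).
Proof.
split.
- apply/idealIE; exists (fun=> 0); first by move=> _; apply: OK0.
  by rewrite big1 // => i _; rewrite mul0r.
- move=> y z /idealIE[c Oc ->] /idealIE[e Oe ->]; apply/idealIE.
  exists (fun i => c i + e i); first by move=> i; apply: OKD.
  by rewrite -big_split; apply: eq_bigr => i _; rewrite mulrDl.
move=> u y Ou /idealIE[c Oc ->]; apply/idealIE.
exists (fun i => u * c i); first by move=> i; apply: OKM.
by rewrite mulr_sumr; apply: eq_bigr => i _; rewrite mulrA.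
Qed.

Lemma idealI_gen (xi : 'I_n -> K) d i : idealI p xi d (xi i ^+ (p ^ d) - xi i).
Proof.
apply/idealIE; exists (fun j => (i == j)%:R); first by move=> j; apply: OK_nat.
rewrite (bigD1 i) //= eqxx mul1r big1 ?addr0 // => j /negbTE.
by rewrite eq_sym => ->; rewrite mul0r.
Qed.

(** Indeed [(1 + p)^(p^d)] is 1 modulo [p^2], so that [u] is -1 modulo [p]. *)
Lemma succ_prime_exp d : (0 < d)%N ->
  exists2 u, coprime p u & (p.+1 ^ (p ^ d) = p.+1 + p * u)%N.
Proof.
move=> d0; have [v Ev] : exists v, (p.+1 ^ (p ^ d) = 1 + p ^ 2 * v)%N.
  have [v ->] : exists v, (p.+1 ^ (p ^ d) = 1 + (p ^ d) * p + p ^ 2 * v)%N.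
    elim: (p ^ d)%N => [|m [v Ev]]; first by exists 0%N; rewrite mul0n muln0 addn0.
    by exists (m + v + v * p)%N; rewrite expnS Ev; ring.
  by exists (p ^ d.-1 + v)%N; rewrite -(prednK d0) expnSr /=; ring.
have p1 := prime_gt1 pp.
have v0 : (0 < v)%N.
  case: v Ev => // /eqP; rewrite muln0 addn0 -[X in _ == X](exp1n (p ^ d)) eqn_exp2r //.
    by lia.
  by rewrite expn_gt0 prime_gt0.
exists (p * v).-1; last by rewrite Ev -mulnn; nia.
have pv0 : (0 < p * v)%N by rewrite muln_gt0 v0 prime_gt0.
rewrite (@coprime_dvdl _ (p * v)) ?dvdn_mulr //.
by rewrite -{1}(prednK pv0) coprimeSn.
Qed.

(** Let [G] be the gcd of [f] and [X^(p^d) - X] modulo [p], a squarefree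
    polynomial, and [g] a lift of [G].  Up to integers prime to [p], the four ideals
    I_d, (p, x^(p^d) - x), (p, g(x)) and the principal ideal given by
    [local_generator] coincide; the index of the third one is p^(deg G). *)
Lemma loc_principal_idealI (i0 : 'I_n) (xi : 'I_n -> K) d : (0 < d)%N ->
    integral_basis (fun i => if i == i0 then 1 else xi i) -> xi i0 = 1 + p%:R ->
  loc_principal p (idealI p xi d) (size (gcdp (red f) ('X^(p ^ d) - 'X))).-1.
Proof.
move=> d0 hb hxi; set Q := (p ^ d)%N; pose A := idealI p xi d.
have iA : ideal_like A := idealI_ideal xi d; have [A0 AD AM] := iA.
have gA := ideal_subgroup iA.
have [s1 cs1 Es1] := succ_prime_exp d0.
have s1_0 : (0 < s1)%N.
  by case: s1 cs1 {Es1} => //; rewrite /coprime gcdn0 => /eqP p1; have := prime_gt1 pp; rewrite p1.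
have Op : O p%:R := OK_nat K p; have Os1 : O s1%:R := OK_nat K s1.
have xiO i : O (xi i).
  have [bO _] := hb; have := bO i; case: eqP => // -> _.
  by rewrite hxi; apply: OKD => //; apply: OK1.
(* This is the generator given by xi_1 = 1 + p. *)
have As1p : A (s1%:R * p%:R).
  have := idealI_gen xi d i0; rewrite hxi -[1 + _](natrD _ 1 p) add1n -natrX Es1.
  by rewrite natrD addrC addKr natrM mulrC.
(* The basis element 1 contributes 1^(p^d) - 1 = 0. *)
have Afrob y : O y -> A (s1%:R * (y ^+ Q - y)).
  move=> Oy; pose b i := if i == i0 then 1 else xi i.
  have bO : forall i, O (b i) by case: hb.
  have [c Ec] := basis_coord hb Oy.
  have Ey : y = \sum_i (c i)%:~R * b i by rewrite Ec; apply: eq_bigr => i _; rewrite mulrC mulrzr.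
  have [t Ot E] := frobenius_comb d c bO.
  rewrite Ey E -/Q addrAC -sumrB mulrDr; apply: (AD).
    apply: (AM) => //; apply: (big_ind _ A0 AD) => i _; rewrite -mulrBr; apply: (AM); first exact: OK_int.
    rewrite /b; case: eqP => _; first by rewrite expr1n subrr.
    exact: idealI_gen.
  by rewrite mulrA mulrC; apply: (AM).
have Apair y : pair_ideal (x ^+ Q - x) y -> A (s1%:R * y).
  move=> [s [t [Os Ot ->]]]; rewrite mulrDr; apply: (AD).
    by rewrite mulrA mulrC; apply: (AM).
  by rewrite mulrA mulrC; apply: (AM) => //; apply: Afrob.
pose P := gcdp (red f) ('X^Q - 'X); pose G := (lead_coef P)^-1 *: P.
have P0 : P != 0 by rewrite gcdp_eq0 negb_and red_f_neq0.
have lP : (lead_coef P)^-1 != 0 by rewrite invr_eq0 lead_coef_eq0.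
have mG : G \is monic by rewrite monicE lead_coefZ mulVf ?lead_coef_eq0.
have GP : G %= P by apply: eqp_scale.
have Gf : G %| red f by rewrite (eqp_dvdl _ GP) dvdp_gcdl.
have GX : G %| 'X^Q - 'X by rewrite (eqp_dvdl _ GP) dvdp_gcdr.
pose g := lift G; have mg : g \is monic by apply: lift_monic.
have rg : red g = G by rewrite liftK.
have [k Ek] : exists k, f = g * lift (red f %/ G) + p%:Z *: k.
  by apply: (red_eq pp); rewrite redM rg liftK // mulrC divpK.
(* The derivative is -1. *)
have sepX : separable_poly ('X^Q - 'X : {poly 'F_p}).
  rewrite separable_poly.unlock derivB derivXn derivX -mulr_natr -polyC_natr natrX.
  rewrite (pcharf0 (pchar_Fp pp)) expr0n eqn0Ngt d0 mulr0 sub0r.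
  by rewrite -[X in coprimep _ X]scaleN1r coprimepZr ?oppr_eq0 ?oner_neq0 // coprimep1.
have sepg : separable_poly (red g) by rewrite rg; apply: dvdp_separable GX sepX.
have [c [B [e El]]] := local_generator Ek sepg.
set al := ev x (g + p%:Z *: c) in El; set u := 1 + _ in El.
have Oal : O al := OK_ev _; have Oe := OK_ev e; have OB := OK_ev B.
have pK : p%:R != 0 :> K by apply: nat_neq0; apply: prime_gt0.
have u0 : u != 0.
  apply: contraTneq isT => u0.
  have E1 : ev x 1 = p%:R * - ev x e.
    by apply/eqP; rewrite ev1 -subr_eq0 mulrN opprK -/u u0.
  have := ev_in_p (OKN Oe) E1 mf sf f0.
  by rewrite [red 1]rmorph1 dvdp1 size_red_f eqSS eqn0Ngt n0.
have al0 : al != 0.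
  by apply: contraTneq (mulf_neq0 pK u0) => al0; rewrite -El al0 mul0r eqxx.
have [s2 [s2_0 cs2 [t2 Ot2 Es2]]] := unit_dvd_nat Oe u0.
have Eal : al = ev x g + p%:R * ev x c by rewrite /al evD evZ -pmulrn.
have als2p : exists2 t, O t & s2%:R * p%:R = al * t.
  exists (ev x B * t2); first exact: OKM.
  by rewrite [RHS]mulrA El Es2 -/u; ring.
have alJ y : pair_ideal (ev x g) y -> dilate al O (s2%:R * y).
  move=> [s [t [Os Ot ->]]]; have [v Ov Ev] := als2p.
  exists (v * s + (s2%:R - v * ev x c) * t).
    apply: OKD; apply: OKM => //; apply: OKB; first exact: OK_nat.
    by apply: OKM => //; apply: OK_ev.
  rewrite (_ : ev x g = al - p%:R * ev x c); last by rewrite Eal; ring.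
  rewrite (_ : _ * _ = s2%:R * p%:R * (s - ev x c * t) + al * s2%:R * t); last by ring.
  by rewrite Ev; ring.
have Jal y : dilate al O y -> pair_ideal (ev x g) y.
  move=> [z Oz ->]; rewrite Eal; exists (ev x c * z), z; split=> //; last by ring.
  by apply: OKM => //; apply: OK_ev.
(* The ideals (p, g(x)) and (p, x^(p^d) - x) are equal, by a Bezout identity
   modulo p and by G | X^(p^d) - X. *)
have gx : pair_ideal (x ^+ Q - x) (ev x g).
  have [[U V] /= UV] := Bezoutp (red f) ('X^Q - 'X).
  have [U' [V' UV']] : exists U' V', G = U' * red f + V' * ('X^Q - 'X).
    have : G %= U * red f + V * ('X^Q - 'X) by rewrite (eqp_trans GP) // eqp_sym.
    case/eqpf_eq => b _ ->.
    by exists (b *: U), (b *: V); rewrite scalerDr !scalerAl.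
  have [m Em] : exists m, g = lift U' * f + lift V' * ('X^Q - 'X) + p%:Z *: m.
    apply: (red_eq pp); rewrite rg redD !redM !liftK // redB UV'.
    by rewrite /red map_polyXn map_polyX.
  rewrite Em !(evD, evM, evN, evZ) f0 mulr0 add0r evXn (evXn x 1) -pmulrn.
  exists (ev x m), (ev x (lift V')); split; try exact: OK_ev.
  by rewrite expr1; ring.
have xg : pair_ideal (ev x g) (x ^+ Q - x).
  have [m Em] : exists m, 'X^Q - 'X = lift (('X^Q - 'X) %/ G) * g + p%:Z *: m.
    by apply: (red_eq pp); rewrite redM liftK // rg divpK // redB /red map_polyXn map_polyX.
  have := congr1 (ev x) Em; rewrite evB evXn (evXn x 1) evD evM evZ -pmulrn expr1 => ->.
  exists (ev x m), (ev x (lift (('X^Q - 'X) %/ G))); split; try exact: OK_ev.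
  by ring.
have sub g1 g2 y : pair_ideal g1 g2 -> pair_ideal g2 y -> pair_ideal g1 y.
  move=> h [s [t [Os Ot ->]]]; have [_ JD JM] := pair_ideal_ideal g1.
  by apply: (JD); [apply: pair_idealP | rewrite mulrC; apply: (JM)].
have AJ y : A y -> pair_ideal (ev x g) y.
  move=> /idealIE[b Ob ->]; have [J0 JD JM] := pair_ideal_ideal (ev x g).
  apply: (big_ind _ J0 JD) => i _; apply: (JM) => //; apply: sub xg _.
  exact: pair_ideal_frobenius.
have -> : size (gcdp (red f) ('X^Q - 'X)) = size g by rewrite size_lift size_scale.
split=> //; exists al => //; split.
  exists (s1 * s2)%N; rewrite muln_gt0 s1_0 s2_0 coprimeMr cs1 cs2; split=> //.
    move=> y /AJ/alJ[t Ot E]; exists (s1%:R * t); first exact: OKM.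
    by rewrite natrM -mulrA E; ring.
  rewrite natrM mulrAC mulrC; apply: (AM); first exact: OK_nat.
  apply: Apair; apply: sub gx _; apply: Jal; exists 1; rewrite ?mulr1 //; exact: OK1.
have gO := OK_subgroup K.
have iJ := index_pair_ideal mg (eq_ind_r (fun z => z %| red f) Gf rg).
have [N iN EN] : exists2 N, has_index O (dilate al O) N &
    logn p N = logn p (p ^ (size g).-1).
  apply: (index_commensurable heta _ _ _ _ s2_0 cs2 _ _ iJ).
  - exact/ideal_subgroup/pair_ideal_ideal.
  - exact: subgroup_dilate.
  - move=> _ [s [t [Os Ot ->]]]; apply: OKD; first exact: OKM.
    by apply: OKM => //; apply: OK_ev.
  - by move=> _ [z Oz ->]; apply: OKM.
  - exact: alJ.
  move=> y h; have [_ _ JM] := pair_ideal_ideal (ev x g).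
  by apply: (JM); [apply: OK_nat | apply: Jal].
have := has_val_int p heta Oal al0.
by rewrite (pvalE _ iN) EN pfactorK.
Qed.

End Monogenic.

(** * Comparison of the dimension with the norm *)

Theorem mainTheorem8 (K : fieldExtType rat) (n p : nat)
  (hn : \dim {:K} = n) (hp : prime p)
  (i0 : 'I_n) (hi0 : nat_of_ord i0 = 0%N)
  (xi : 'I_n -> K)
  (hbasis : integral_basis (fun i => if i == i0 then 1 else xi i))
  (hxi : xi i0 = 1 + p%:R)
  (eta : 'I_n -> K) (heta : integral_basis eta)
  (hF : exists k : nat, (1 <= k <= n)%N /\
    (dimensionF n p k < padic_val p (normF p xi k))%R) :
  common_inessential_divisor p eta.
Proof.
move=> x Ox a ha; apply/negPn/negP => pNa.
have n0 : (0 < n)%N := leq_ltn_trans (leq0n _) (ltn_ord i0).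
have [k [/andP[k0 _]]] := hF; apply/negP; rewrite -leNgt.
have [f [mf sf f0]] := char_poly_root heta Ox.
have lp : loc_principal p (divisorF p xi k) (\sum_(d <- divisors k)
    mobius (k %/ d) * (size (gcdp (red p f) ('X^(p ^ d) - 'X))).-1%:Z).
  rewrite /divisorF big_seq [X in loc_principal _ _ X]big_seq.
  elim/big_rec2: _ => [|d z A dk IH]; first exact: loc_principal_OK heta.
  apply: (loc_principalM heta _ IH); apply: (loc_principalX heta).
  apply: (loc_principal_idealI hp n0 heta Ox ha pNa mf sf f0 _ hbasis hxi).
  by move: dk; rewrite -dvdn_divisors //; apply: dvdn_gt0.
rewrite /normF (loc_principal_norm hp heta lp) dimensionFE //.
exact: sum_mobius_size_gcd.
Qed.
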